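(* Let $V$ be a finite dimensional vector space over $k$, let $K$ be a reductive subgroup of $GL(V)$, and let $G$ be a maximal torus in $K$. If $0$ is not a weight of $G$ on $V$, then $\mathcal{D}(V)^K$ has enough finite dimensional modules.
   Context: $k$ is an algebraically closed field of characteristic $0$. $\mathcal{D}(V)$ is the ring of differential operators on $V$ (the Weyl algebra), with the action of $K$ induced from its action on $V$, and $\mathcal{D}(V)^K$ is the ring of invariants. A $k$-algebra $R$ has enough finite dimensional modules if $\bigcap\mathrm{ann}_R M=0$, where the intersection is over all finite dimensional $R$-modules $M$. Weights of $G$ are written additively, so that ''$0$ is not a weight of $G$ on $V$'' means $V^G=0$. *)

(* Defs.v *)
From HB Require Import structures.
From mathcomp Require Import all_boot all_algebra.
From mathcomp Require Import boolp classical_sets functions.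

Set Implicit Arguments.
Unset Strict Implicit.
Unset Printing Implicit Defensive.

Import GRing.Theory.

Local Open Scope classical_set_scope.
Local Open Scope ring_scope.

Section PolynomialFunctions.
Variable k : fieldType.
Implicit Types W : vectType k.

(* [k^o] is [k] seen as a one-dimensional vector space over itself. *)
Inductive polyfun W : set (W -> k^o) :=
| polyfun_cst (c : k) : polyfun (fun=> c)
| polyfun_lin (l : {linear W -> k^o}) : polyfun l
| polyfun_add f g : polyfun f -> polyfun g -> polyfun (fun w => f w + g w)
| polyfun_mul f g :
    polyfun f -> polyfun g -> polyfun (fun w => (f w : k) * g w).

Lemma polyfun_comp W W' (h : 'Hom(W, W')) (f : W' -> k^o) :
  polyfun f -> polyfun (f \o h).
Proof.
elim=> [c|l|{}f g _ Hf _ Hg|{}f g _ Hf _ Hg].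
- exact: polyfun_cst.
- exact: (polyfun_lin (l \o h)).
- exact: polyfun_add Hf Hg.
- exact: polyfun_mul Hf Hg.
Qed.

End PolynomialFunctions.

Section LinearAlgebraicGroups.
Variable k : fieldType.
Implicit Types V W : vectType k.

Definition GL V : set 'End(V) := [set g | lker g == 0%VS].

Record GLsubgroup V := {
  GLset :> set 'End(V);
  GLset_sub : GLset `<=` @GL V;
  GLset1 : GLset \1%VF;
  GLsetM : forall g h, GLset g -> GLset h -> GLset (g \o h)%VF;
  GLsetV : forall g, GLset g -> GLset (g^-1)%VF
}.

Definition GLmem V (G : GLsubgroup V) : 'End(V) -> Prop := GLset G.
Coercion GLmem : GLsubgroup >-> Funclass.

(* Every regular function on [GL V] becomes polynomial after multiplication by
   a power of the determinant, so polynomials on [End V] suffice here. *)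
Definition zclosed V (Z : set 'End(V)) : Prop :=
  exists2 S : set ('End(V) -> k^o), S `<=` @polyfun k 'End(V) &
    Z = [set g | @GL V g /\ forall f, S f -> f g = 0].

Definition zconnected V (Z : set 'End(V)) : Prop :=
  forall A B, zclosed A -> zclosed B -> Z `<=` A `|` B ->
    Z `&` A `&` B = set0 -> Z `&` A = set0 \/ Z `&` B = set0.

(* [GL V] is viewed as the closed subvariety of [End V * End V] formed by the
   pairs (g, g^-1). *)
Definition regular_on V (G : set 'End(V)) (f : 'End(V) -> k) : Prop :=
  exists2 p : 'End(V) * 'End(V) -> k^o, polyfun p &
    forall g, G g -> f g = p (g, (g^-1)%VF).

Definition alg_morphism V W (G : GLsubgroup V) (H : GLsubgroup W)
    (phi : 'End(V) -> 'End(W)) : Prop :=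
  [/\ forall g, G g -> H (phi g),
      forall g h, G g -> G h -> phi (g \o h)%VF = (phi g \o phi h)%VF
    & forall l : {linear 'End(W) -> k^o}, regular_on G (fun g => l (phi g))].

Definition alg_isomorphic V W (G : GLsubgroup V) (H : GLsubgroup W) : Prop :=
  exists phi psi,
    [/\ alg_morphism G H phi, alg_morphism H G psi,
        forall g, G g -> psi (phi g) = g
      & forall h, H h -> phi (psi h) = h].

Definition diag_lfun r (d : 'rV[k]_r) : 'End('rV[k]_r) :=
  linfun (mulmxr (diag_mx d)).

Lemma diag_lfunE r (d v : 'rV[k]_r) : diag_lfun d v = v *m diag_mx d.
Proof. by rewrite lfunE. Qed.

Lemma diag_lfunM r (d e : 'rV[k]_r) :
  (diag_lfun d \o diag_lfun e)%VF = diag_lfun (\row_i (d 0 i * e 0 i)).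
Proof.
apply/lfunP => v; rewrite comp_lfunE !diag_lfunE -mulmxA; congr (_ *m _).
rewrite mulmx_diag; congr diag_mx.
by apply/rowP => i; rewrite !mxE mulrC.
Qed.

Lemma diag_lfun1 r : diag_lfun (const_mx 1 : 'rV[k]_r) = \1%VF.
Proof.
by apply/lfunP => v; rewrite diag_lfunE diag_const_mx mulmx1 id_lfunE.
Qed.

Definition diag_set r : set 'End('rV[k]_r) :=
  [set g | exists2 d : 'rV[k]_r, forall i, d 0 i != 0 & g = diag_lfun d].

Lemma diag_lfun_inv r (d : 'rV[k]_r) : (forall i, d 0 i != 0) ->
  (diag_lfun d \o diag_lfun (\row_i (d 0 i)^-1)%R)%VF = \1%VF.
Proof.
move=> d0; rewrite diag_lfunM -diag_lfun1; congr diag_lfun.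
by apply/rowP => i; rewrite !mxE mulfV.
Qed.

Lemma diag_lfun_invl r (d : 'rV[k]_r) : (forall i, d 0 i != 0) ->
  (diag_lfun (\row_i (d 0 i)^-1)%R \o diag_lfun d)%VF = \1%VF.
Proof.
move=> d0; rewrite diag_lfunM -diag_lfun1; congr diag_lfun.
by apply/rowP => i; rewrite !mxE mulVf.
Qed.

Lemma diag_set_sub r : @diag_set r `<=` @GL 'rV[k]_r.
Proof.
move=> _ [d d0 ->]; apply/lker0P => u v.
move=> /(congr1 (diag_lfun (\row_i (d 0 i)^-1)%R)).
by rewrite -!comp_lfunE diag_lfun_invl // !id_lfunE.
Qed.

Lemma diag_set1 r : @diag_set r \1%VF.
Proof.
by exists (const_mx 1); [move=> i; rewrite mxE oner_neq0 | rewrite diag_lfun1].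
Qed.

Lemma diag_setM r g h :
  @diag_set r g -> @diag_set r h -> @diag_set r (g \o h)%VF.
Proof.
move=> [d d0 ->] [e e0 ->]; exists (\row_i (d 0 i * e 0 i)).
  by move=> i; rewrite mxE mulf_neq0.
exact: diag_lfunM.
Qed.

Lemma diag_setV r g : @diag_set r g -> @diag_set r (g^-1)%VF.
Proof.
move=> Dg; have g0 := diag_set_sub Dg; case: Dg => d d0 gd.
exists (\row_i (d 0 i)^-1); first by move=> i; rewrite mxE invr_eq0.
rewrite -[LHS]comp_lfun1r -(diag_lfun_inv d0) -gd comp_lfunA.
by rewrite lker0_compVf // comp_lfun1l.
Qed.

Definition diag_torus r : GLsubgroup 'rV[k]_r :=
  {| GLset_sub := @diag_set_sub r; GLset1 := @diag_set1 r;
     GLsetM := @diag_setM r; GLsetV := @diag_setV r |}.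

Definition is_torus V (T : GLsubgroup V) : Prop :=
  zclosed T /\ exists r, alg_isomorphic T (diag_torus r).

Definition is_maximal_torus V (K T : GLsubgroup V) : Prop :=
  [/\ is_torus T, T `<=` K &
      forall T' : GLsubgroup V,
        is_torus T' -> T' `<=` K -> T `<=` T' -> T' `<=` T].

Definition is_unipotent V (g : 'End(V)) : Prop :=
  exists m, forall v, iter m (g - \1)%VF v = 0.

Definition is_normal V (N K : GLsubgroup V) : Prop :=
  N `<=` K /\ forall g h, K g -> N h -> N (g \o h \o g^-1)%VF.

(* The unipotent radical is trivial; reductive groups may be disconnected. *)
Definition is_reductive V (K : GLsubgroup V) : Prop :=
  zclosed K /\
  forall U : GLsubgroup V,
    zclosed U -> zconnected U -> is_normal U K -> U `<=` @is_unipotent V ->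
    U `<=` [set \1%VF].

Definition is_character V (G : GLsubgroup V) (chi : 'End(V) -> k) : Prop :=
  [/\ forall g, G g -> chi g != 0,
      forall g h, G g -> G h -> chi (g \o h)%VF = chi g * chi h
    & regular_on G chi].

Definition is_weight V (G : GLsubgroup V) (chi : 'End(V) -> k) : Prop :=
  is_character G chi /\
  exists2 v : V, v != 0 & forall g, G g -> g v = chi g *: v.

(* Characters are multiplicative functions here, so that the weight written 0
   additively is the constant function 1. *)
Definition weight0 V : 'End(V) -> k := fun=> 1.

Lemma weight0P V (G : GLsubgroup V) :
  ~ is_weight G (@weight0 V) <->
  (forall v : V, (forall g, G g -> g v = v) -> v = 0).
Proof.
split=> [nw v fix_v|inv0 [_ [v v0 Gv]]]; last first.
  move/eqP: v0; apply; apply: inv0 => g /Gv.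
  by rewrite /weight0 scale1r.
apply/eqP/negPn/negP => v0; apply: nw; split.
  split=> [g _|g h _ _|]; rewrite /weight0 ?oner_neq0 ?mulr1 //.
  by exists (fun=> 1); first exact: polyfun_cst.
by exists v => // g /fix_v; rewrite /weight0 scale1r.
Qed.

End LinearAlgebraicGroups.

Section WeylAlgebra.
Variables (k : closedFieldType) (V : vectType k).

Definition polyfun_pred : {pred (V -> k^o)} := fun f => `[< polyfun f >].

Definition coordRing := {f : V -> k^o | f \in polyfun_pred}.

Lemma polyfun_subring : subring_closed polyfun_pred.
Proof.
split=> [|f g /asboolP Hf /asboolP Hg|f g /asboolP Hf /asboolP Hg];
  apply/asboolP.
- exact: polyfun_cst.
- suff -> : f - g = (fun w => f w + ((-1 : k) * g w)).
    exact: polyfun_add Hf (polyfun_mul (polyfun_cst _ _) Hg).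
  by apply/funext => w; rewrite mulN1r.
- exact: polyfun_mul.
Qed.

Lemma polyfun_submod : submod_closed polyfun_pred.
Proof.
split=> [|a f g /asboolP Hf /asboolP Hg]; apply/asboolP.
  exact: polyfun_cst.
exact: polyfun_add (polyfun_mul (polyfun_cst _ a) Hf) Hg.
Qed.

HB.instance Definition _ :=
  GRing.isSubringClosed.Build (V -> k^o) polyfun_pred polyfun_subring.
HB.instance Definition _ :=
  GRing.isSubmodClosed.Build k (V -> k^o) polyfun_pred polyfun_submod.

HB.instance Definition _ := SubChoice.on coordRing.
HB.instance Definition _ :=
  GRing.SubChoice_isSubComPzRing.Build (V -> k^o) polyfun_pred coordRing
    polyfun_subring.
HB.instance Definition _ :=
  GRing.SubZmodule_isSubLmodule.Build k (V -> k^o) polyfun_pred coordRing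
    polyfun_submod.

Fact coordRing_nz : 1 != 0 :> coordRing.
Proof.
by apply/eqP => /(congr1 (fun f : coordRing => val f 0)) /eqP; rewrite oner_eq0.
Qed.
HB.instance Definition _ :=
  GRing.PzSemiRing_isNonZero.Build coordRing coordRing_nz.

Fact coordRing_scaleAl (a : k) (f g : coordRing) : a *: (f * g) = (a *: f) * g.
Proof. by apply/val_inj/funext => v; exact: mulrA. Qed.
HB.instance Definition _ :=
  GRing.Lmodule_isLalgebra.Build k coordRing coordRing_scaleAl.
HB.instance Definition _ := GRing.Lalgebra_isComAlgebra.Build k coordRing.

Lemma coordRingP (f : coordRing) : polyfun (val f).
Proof. exact/asboolP/(valP f). Qed.

Definition mkCoord (f : V -> k^o) (Hf : polyfun f) : coordRing :=
  exist _ f (introT (asboolP _) Hf).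

Definition linear_pred : {pred (coordRing -> coordRing)} :=
  fun D => `[< linear D >].

Definition endCoord := {D : coordRing -> coordRing | D \in linear_pred}.

Lemma linear_submod : submod_closed linear_pred.
Proof.
split=> [|a D E /asboolP HD /asboolP HE]; apply/asboolP => b f g.
  by rewrite [RHS](_ : _ = b *: 0 + 0) // scaler0 addr0.
have apE h : (a *: D + E) h = a *: D h + E h by [].
rewrite !apE HD HE !scalerDr !scalerA (mulrC a) -!addrA; congr (_ + _).
by rewrite addrCA.
Qed.

HB.instance Definition _ :=
  GRing.isSubmodClosed.Build k (coordRing -> coordRing) linear_pred
    linear_submod.
HB.instance Definition _ := SubChoice.on endCoord.
HB.instance Definition _ :=
  GRing.SubChoice_isSubLmodule.Build k (coordRing -> coordRing) linear_pred
    endCoord linear_submod.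

Lemma endCoordP (D : endCoord) : linear (val D).
Proof. exact/asboolP/(valP D). Qed.

Definition mkEnd (D : coordRing -> coordRing) (HD : linear D) : endCoord :=
  exist _ D (introT (asboolP _) HD).

Definition endCoord_one : endCoord := @mkEnd id (fun a f g => erefl).

Fact endCoord_mul_subproof (D E : endCoord) : linear (val D \o val E).
Proof. by move=> a f g /=; rewrite !endCoordP. Qed.
Definition endCoord_mul D E : endCoord := mkEnd (endCoord_mul_subproof D E).

Fact endCoord_mulA : associative endCoord_mul.
Proof. by move=> D E F; apply/val_inj. Qed.
Fact endCoord_mul1l : left_id endCoord_one endCoord_mul.
Proof. by move=> D; apply/val_inj. Qed.
Fact endCoord_mul1r : right_id endCoord_one endCoord_mul.
Proof. by move=> D; apply/val_inj. Qed.
Fact endCoord_mulDl : left_distributive endCoord_mul +%R.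
Proof. by move=> D E F; apply/val_inj. Qed.
Fact endCoord_mulDr : right_distributive endCoord_mul +%R.
Proof.
move=> D E F; apply/val_inj/funext => f /=.
by have := endCoordP D 1 (val E f) (val F f); rewrite !scale1r.
Qed.
Fact endCoord_nz : endCoord_one != 0.
Proof.
apply/eqP => /(congr1 (fun D : endCoord => val D 1)) /eqP.
by rewrite (negbTE coordRing_nz).
Qed.
HB.instance Definition _ := GRing.Zmodule_isNzRing.Build endCoord
  endCoord_mulA endCoord_mul1l endCoord_mul1r endCoord_mulDl endCoord_mulDr
  endCoord_nz.

Fact endCoord_scaleAl (a : k) (D E : endCoord) : a *: (D * E) = (a *: D) * E.
Proof. exact/val_inj. Qed.
HB.instance Definition _ :=
  GRing.Lmodule_isLalgebra.Build k endCoord endCoord_scaleAl.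

Fact endCoord_scaleAr (a : k) (D E : endCoord) : a *: (D * E) = D * (a *: E).
Proof.
apply/val_inj/funext => f /=.
rewrite [RHS](_ : _ = val D (a *: val E f + 0)); last by rewrite addr0.
have D0 : val D 0 = 0.
  by have := endCoordP D (-1) 0 0; rewrite scaler0 addr0 scaleN1r addNr.
by rewrite endCoordP D0 addr0.
Qed.
HB.instance Definition _ :=
  GRing.Lalgebra_isAlgebra.Build k endCoord endCoord_scaleAr.

Fact mulop_linear (f : coordRing) : linear ( *%R f).
Proof. by move=> a g h; rewrite mulrDr scalerAr. Qed.
Definition mulop f : endCoord := mkEnd (mulop_linear f).

(* The polynomial t |-> f (u + t v); it is unique because k is infinite. *)
Definition line_poly (f : V -> k) (v u : V) : {poly k} :=
  xget 0 [set p : {poly k} | forall t, p.[t] = f (u + t *: v)].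

Lemma line_poly_unique f v u (p : {poly k}) :
  (forall t, p.[t] = f (u + t *: v)) -> line_poly f v u = p.
Proof.
move=> Hp; rewrite /line_poly; case: xgetP => [q _ Hq|/(_ p)//].
apply/eqP; rewrite -subr_eq0; apply/negPn/negP => /closed_nonrootP [x].
by rewrite rootE hornerD hornerN Hp Hq subrr eqxx.
Qed.

Lemma line_polyE f v u : polyfun f ->
  forall t, (line_poly f v u).[t] = f (u + t *: v).
Proof.
move=> Hf; suff [p Hp] : exists p : {poly k}, forall t, p.[t] = f (u + t *: v).
  by rewrite (line_poly_unique Hp).
elim: Hf => [c|l|{}f g _ [p Hp] _ [q Hq]|{}f g _ [p Hp] _ [q Hq]].
- by exists c%:P => t; rewrite hornerC.
- exists ((l u)%:P + (l v : k) *: 'X) => t.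
  by rewrite hornerD hornerC hornerZ hornerX linearD linearZ /= mulrC.
- by exists (p + q) => t; rewrite hornerD Hp Hq.
- by exists (p * q) => t; rewrite hornerM Hp Hq.
Qed.

Definition dir_deriv (v : V) (f : V -> k) (u : V) : k^o :=
  (line_poly f v u)^`().[0].

Lemma dir_deriv_cst v c : dir_deriv v (fun=> c) = fun=> 0.
Proof.
apply/funext => u; rewrite /dir_deriv (@line_poly_unique _ _ _ c%:P).
  by rewrite derivC horner0.
by move=> t; rewrite hornerC.
Qed.

Lemma dir_deriv_lin v (l : {linear V -> k^o}) : dir_deriv v l = fun=> l v.
Proof.
apply/funext => u.
rewrite /dir_deriv (@line_poly_unique _ _ _ ((l u)%:P + (l v : k) *: 'X)).
  by rewrite derivD derivC add0r derivZ derivX hornerZ hornerC mulr1.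
by move=> t; rewrite hornerD hornerC hornerZ hornerX linearD linearZ /= mulrC.
Qed.

Lemma dir_derivD v f g : polyfun f -> polyfun g ->
  dir_deriv v (fun w => f w + g w) = fun w => dir_deriv v f w + dir_deriv v g w.
Proof.
move=> Hf Hg; apply/funext => u; rewrite /dir_deriv -hornerD -derivD.
by congr _^`().[_]; apply: line_poly_unique => t; rewrite hornerD !line_polyE.
Qed.

Lemma dir_derivM v (f g : V -> k^o) : polyfun f -> polyfun g ->
  dir_deriv v (fun w => (f w : k) * g w) =
  fun w => (dir_deriv v f w : k) * g w + (f w : k) * dir_deriv v g w.
Proof.
move=> Hf Hg; apply/funext => u; rewrite /dir_deriv.
rewrite (@line_poly_unique _ _ _ (line_poly f v u * line_poly g v u)).
  by rewrite derivM hornerD !hornerM !line_polyE // !scale0r !addr0.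
by move=> t; rewrite hornerM !line_polyE.
Qed.

Lemma dir_deriv_polyfun v f : polyfun f -> polyfun (dir_deriv v f).
Proof.
elim=> [c|l|{}f g pf Hf pg Hg|{}f g pf Hf pg Hg].
- by rewrite dir_deriv_cst; apply: polyfun_cst.
- by rewrite dir_deriv_lin; apply: polyfun_cst.
- by rewrite dir_derivD //; apply: polyfun_add.
- rewrite dir_derivM //.
  by apply: polyfun_add; apply: polyfun_mul.
Qed.

Definition derivop_fun v (f : coordRing) : coordRing :=
  mkCoord (dir_deriv_polyfun v (coordRingP f)).

Fact derivop_linear v : linear (derivop_fun v).
Proof.
move=> a f g; apply/val_inj => /=.
rewrite [LHS](@dir_derivD v (fun w => (a : k) * val f w) (val g)).
- rewrite (@dir_derivM v (fun=> a) (val f)).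
  + by apply/funext => w; rewrite dir_deriv_cst mul0r add0r.
  + exact: polyfun_cst.
  + exact: coordRingP.
- exact: polyfun_mul (polyfun_cst _ _) (coordRingP f).
- exact: coordRingP.
Qed.
Definition derivop v : endCoord := mkEnd (derivop_linear v).

Inductive gen_subalg (A : algType k) (S : set A) : set A :=
| gen_subalg_incl a : S a -> gen_subalg S a
| gen_subalg1 : gen_subalg S 1
| gen_subalg_lin (c : k) a b :
    gen_subalg S a -> gen_subalg S b -> gen_subalg S (c *: a + b)
| gen_subalgM a b : gen_subalg S a -> gen_subalg S b -> gen_subalg S (a * b).

(* The Weyl algebra of V as a ring of operators on k[V]; in characteristic 0
   it is the ring of all differential operators on V. *)
Definition weyl_pred : {pred endCoord} :=
  fun D => `[< gen_subalg (range mulop `|` range derivop) D >].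

Definition weyl := {D : endCoord | D \in weyl_pred}.

Lemma weyl_subalg : subalg_closed weyl_pred.
Proof.
split=> [|c D E /asboolP HD /asboolP HE|D E /asboolP HD /asboolP HE];
  apply/asboolP.
- exact: gen_subalg1.
- exact: gen_subalg_lin.
- exact: gen_subalgM.
Qed.

HB.instance Definition _ := SubChoice.on weyl.
HB.instance Definition _ :=
  GRing.SubChoice_isSubAlgebra.Build k endCoord weyl_pred weyl weyl_subalg.

Fact actop_subproof (g : 'End(V)) :
  linear (fun f : coordRing => mkCoord (polyfun_comp (g^-1)%VF (coordRingP f))).
Proof. by move=> a f h; apply/val_inj. Qed.

(* (g f)(v) = f (g^-1 v) *)
Definition actop (g : 'End(V)) : endCoord := mkEnd (actop_subproof g).

Definition conjop (g : 'End(V)) (D : endCoord) : endCoord :=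
  actop g * D * actop (g^-1)%VF.

Lemma GLV (g : 'End(V)) : GL g -> GL (g^-1)%VF.
Proof.
by move=> Hg; apply/lker0P; apply: (can_inj (g := g)); exact: lker0_lfunVK.
Qed.

Lemma GLVK (g : 'End(V)) : GL g -> (g^-1^-1)%VF = g.
Proof.
move=> Hg; apply/lfunP => v; have gV := GLV Hg.
by rewrite -{1}[v](lker0_lfunK Hg) (lker0_lfunK gV).
Qed.

Lemma actopV (g : 'End(V)) : GL g -> actop (g^-1)%VF * actop g = 1.
Proof.
move=> Hg; apply/val_inj/funext => f; apply/val_inj/funext => v /=.
by rewrite GLVK // lker0_lfunK.
Qed.

Lemma actopVr (g : 'End(V)) : GL g -> actop g * actop (g^-1)%VF = 1.
Proof. by move=> Hg; rewrite -[in RHS](actopV (GLV Hg)) GLVK. Qed.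

Lemma conjop1 (g : 'End(V)) : GL g -> conjop g 1 = 1.
Proof. by move=> Hg; rewrite /conjop mulr1 actopVr. Qed.

Lemma conjop_lin (g : 'End(V)) (c : k) D E :
  conjop g (c *: D + E) = c *: conjop g D + conjop g E.
Proof. by rewrite /conjop mulrDr mulrDl -scalerAr -scalerAl. Qed.

Lemma conjopM (g : 'End(V)) D E :
  GL g -> conjop g (D * E) = conjop g D * conjop g E.
Proof.
move=> Hg; rewrite /conjop -!mulrA; congr (_ * (_ * _)).
by rewrite !mulrA actopV // mul1r.
Qed.

Lemma conjop_mulop (g : 'End(V)) f :
  GL g -> conjop g (mulop f) = mulop (val (actop g) f).
Proof.
move=> Hg; apply/val_inj/funext => h; apply/val_inj/funext => v /=.
rewrite GLVK //.
rewrite [LHS](_ : _ = (val f (g^-1%VF v) : k) * val h (g (g^-1%VF v))) //.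
by rewrite lker0_lfunVK.
Qed.

Lemma conjop_derivop (g : 'End(V)) v :
  GL g -> conjop g (derivop v) = derivop (g v).
Proof.
move=> Hg; apply/val_inj/funext => h; apply/val_inj/funext => u /=.
rewrite GLVK // /dir_deriv; congr _^`().[_].
apply: line_poly_unique => t; rewrite line_polyE; last exact: coordRingP.
by rewrite /= linearD linearZ /= lker0_lfunVK.
Qed.

(* Hence conjugation by [actop g] is an action of GL(V) on the Weyl algebra. *)
Lemma conjop_weyl (g : 'End(V)) D :
  GL g -> D \in weyl_pred -> conjop g D \in weyl_pred.
Proof.
move=> Hg /asboolP HD; apply/asboolP; elim: HD => [{}D HD||c {}D E _ HD _ HE|].
- apply: gen_subalg_incl; case: HD => -[x _ <-]; [left|right].
    by rewrite conjop_mulop //; exists (val (actop g) x).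
  by rewrite conjop_derivop //; exists (g x).
- by rewrite conjop1 //; exact: gen_subalg1.
- by rewrite conjop_lin; exact: gen_subalg_lin.
- by move=> {}D E _ HD _ HE; rewrite conjopM //; exact: gen_subalgM.
Qed.

Section Invariants.
Variable K : GLsubgroup V.

Definition inv_pred : {pred weyl} :=
  fun D => `[< forall g, K g -> conjop g (val D) = val D >].

Definition weyl_inv := {D : weyl | D \in inv_pred}.

Lemma inv_subalg : subalg_closed inv_pred.
Proof.
split=> [|c D E /asboolP HD /asboolP HE|D E /asboolP HD /asboolP HE];
  apply/asboolP => g Kg.
- by rewrite conjop1 //; exact: GLset_sub Kg.
- by rewrite conjop_lin HD // HE.
- by rewrite conjopM ?HD ?HE //; exact: GLset_sub Kg.
Qed.

HB.instance Definition _ := SubChoice.on weyl_inv.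
HB.instance Definition _ :=
  GRing.SubChoice_isSubAlgebra.Build k weyl inv_pred weyl_inv inv_subalg.

End Invariants.

End WeylAlgebra.

Section Modules.
Variables (k : fieldType) (A : algType k).

(* [M] is a vector space over [k] through [c |-> c%:A]. *)
Definition finite_dimensional (M : lmodType A) : Prop :=
  exists n (e : 'I_n -> M),
    forall m : M, exists c : 'I_n -> k, m = \sum_(i < n) (c i)%:A *: e i.

Definition ann (M : lmodType A) : set A := [set a | forall m : M, a *: m = 0].

Definition enough_fd_modules : Prop :=
  [set a : A | forall M : lmodType A, finite_dimensional M -> ann M a]
  = [set 0].

End Modules.

(* Main.v *)
(** An element of [D(V)] invariant under [K] is invariant under every single
    element of the torus [G], and having enough finite dimensional modules
    passes to subrings. Since [0] is not a weight of [G], a generic point [g] of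
    a generic one-parameter subgroup of [G] is diagonalizable with eigenvalues
    [2 ^ m_i], all [m_i] nonzero, so it suffices to treat the invariants of this
    one [g], which form the weight [0] part of [D(V)] for the grading where
    [x_i] has weight [- m_i] and [d_i] has weight [m_i].

    Let [J] be the left ideal of [D(V)] generated by the generators of negative
    weight. The module [D(V) / J] is spanned by words in the generators of
    positive weight, so its weight spaces are finite dimensional, and they are
    stable under the weight [0] part of [D(V)]. As [D(V)] is simple, the module
    is faithful if it is nonzero. That [1] is not in [J] is witnessed by a
    linear functional [phi] on [D(V)] that kills [J] and has [phi 1 = 1]; the
    module is then realized inside the functions on [D(V)], as the submodule
    generated by [phi]. *)
From HB Require Import structures.
Require Import Defs.
From mathcomp Require Import all_boot all_order all_algebra.
From mathcomp Require Import boolp classical_sets functions.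

Set Implicit Arguments.
Unset Strict Implicit.
Unset Printing Implicit Defensive.

Import Order.TTheory GRing.Theory Num.Theory.
Local Open Scope ring_scope.

(** * Eigenbases of tori *)

(** For [d > 0] the natural number 2^d - 1 is nonzero, hence nonzero in [k] in characteristic 0;
    negative exponents reduce to this case by inversion. *)
Lemma exp2_eq1 (k : fieldType) (w : int) :
  [pchar k] =i pred0 -> (2 : k) ^ w = 1 -> w = 0.
Proof.
move=> char0; have H d : (2 : k) ^+ d = 1 -> d = 0%N.
  move=> d1; have : ((2 ^ d - 1)%N%:R : k) == 0.
    by rewrite natrB ?expn_gt0 // natrX d1 subrr.
  move/pcharf0P: char0 => ->; rewrite subn_eq0 => d_le.
  by case: d {d1} d_le => // d; rewrite leqNgt -{1}(expn0 2) ltn_exp2l.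
case: w => d; first by move=> /H ->.
by move/(congr1 GRing.inv); rewrite invrK invr1 => /H.
Qed.

(** Newton's scheme: a new node is handled by adding a multiple of [q], which vanishes at the
    earlier nodes and not at the new one. *)
Lemma interpolation (k : fieldType) (T : eqType) (U : T -> k) (S : seq T) (F : T -> k) :
  {in S &, injective U} -> exists p : {poly k}, forall s, s \in S -> p.[U s] = F s.
Proof.
elim: S => [|s S IH] Uinj; first by exists 0.
have [|p Hp] := IH; first by apply: sub_in2 Uinj => t tS; rewrite inE tS orbT.
have [sS|sS] := boolP (s \in S).
  by exists p => t; rewrite inE => /predU1P[->|]; exact: Hp.
pose q := \prod_(a <- map U S) ('X - a%:P).
have q0 t : t \in S -> q.[U t] = 0.
  by move=> tS; apply/eqP; rewrite -/(root q _) root_prod_XsubC map_f.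
have qs : q.[U s] != 0.
  rewrite -/(root q _) root_prod_XsubC; apply: contra sS => /mapP[t tS Ust].
  by rewrite (Uinj s t) // inE ?eqxx // tS orbT.
exists (p + ((F s - p.[U s]) / q.[U s]) *: q) => t.
rewrite inE hornerD hornerZ => /predU1P[->|tS]; first by rewrite divfK // addrC subrK.
by rewrite (q0 t) // mulr0 addr0 Hp.
Qed.

(** With m_i = b^i the pairing with [s] is the value at [b] of the polynomial with coefficients s_i.
    Distinct [s] and [t] have a nonzero difference [P (s, t)], so any [b] that is not a root of the
    product [Q] of these differences works. *)
Lemma generic_pairing r (S : seq {ffun 'I_r -> int}) :
  exists m : 'I_r -> int, {in S &, injective (fun s : {ffun 'I_r -> int} => \sum_i s i * m i)}.
Proof.
pose P (x : {ffun 'I_r -> int} * {ffun 'I_r -> int}) : {poly int} :=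
  \poly_(i < r) (if insub i is Some j then x.1 j - x.2 j else 0).
pose Q := \prod_(x <- [seq x <- [seq (s, t) | s <- S, t <- S] | x.1 != x.2]) P x.
have PE x b : (P x).[b] = \sum_i x.1 i * b ^+ i - \sum_i x.2 i * b ^+ i.
  rewrite horner_poly -sumrB; apply: eq_bigr => i _.
  by rewrite valK mulrBl.
have Q_neq0 : Q != 0.
  rewrite prodf_seq_neq0; apply/allP => x; rewrite mem_filter /= => /andP[xn _].
  apply: contra_neq xn; case: x => s t /= Px0; apply/ffunP => i; apply/eqP; rewrite -subr_eq0.
  have /eqP := congr1 (fun p : {poly int} => p`_i) Px0.
  by rewrite coef_poly ltn_ord valK coef0.
(* These are [size Q] distinct integers, one more than the degree of [Q], so they cannot all be
   roots. *)
pose rs := [seq (i%:Z) | i <- iota 0 (size Q)].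
have : ~~ all (root Q) rs.
  apply/negP => /(max_poly_roots Q_neq0).
  by rewrite size_map size_iota ltnn map_inj_uniq ?iota_uniq => [/(_ isT)|a b []].
case/allPn => b _ Qb; exists (fun i => b ^+ i) => s t sS tS E.
apply/eqP/negPn/negP => st; case/negP: Qb.
rewrite /root horner_prod prodf_seq_eq0; apply/hasP; exists (s, t) => /=.
  by rewrite mem_filter /= st; apply/allpairsP; exists (s, t).
by rewrite PE /= E subrr.
Qed.

Section LaurentSums.
Variables (k : fieldType) (r : nat).
Implicit Types (s t : {ffun 'I_r -> int}) (d : 'rV[k]_r).

Definition monomial s d : k := \prod_i d 0 i ^ s i.

(** Laurent polynomials with coefficients in [W], as functions on the torus of rows with nonzero
    entries. Exponents may recur in the list, so that a sum is a concatenation. *)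
Definition laurent (W : lmodType k) (h : 'rV[k]_r -> W) :=
  exists M : seq (W * {ffun 'I_r -> int}), forall d, (forall i, d 0 i != 0) ->
    h d = \sum_(x <- M) monomial x.2 d *: x.1.

Lemma monomial0 d : monomial [ffun=> 0] d = 1.
Proof. by rewrite /monomial big1 // => i _; rewrite ffunE expr0z. Qed.

Lemma monomialD s t d : (forall i, d 0 i != 0) ->
  monomial [ffun i => s i + t i] d = monomial s d * monomial t d.
Proof.
by move=> d0; rewrite -big_split; apply: eq_bigr => i _; rewrite ffunE expfzDr.
Qed.

Lemma laurent_cst (W : lmodType k) (w : W) : laurent (fun=> w).
Proof.
by exists [:: (w, [ffun=> 0])] => d _; rewrite big_seq1 monomial0 scale1r.
Qed.

Lemma laurent_exp (i : 'I_r) (w : int) : laurent (fun d => d 0 i ^ w : k^o).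
Proof.
exists [:: (1, [ffun j => if j == i then w else 0])] => d _.
rewrite big_seq1 /monomial (bigD1 i) //= ffunE eqxx big1 ?mulr1 => [|j /negbTE ji].
  by rewrite [RHS]mulr1.
by rewrite ffunE ji expr0z.
Qed.

Lemma laurentD (W : lmodType k) (f h : _ -> W) :
  laurent f -> laurent h -> laurent (fun d => f d + h d).
Proof.
by move=> [M HM] [N HN]; exists (M ++ N) => d d0; rewrite big_cat HM ?HN.
Qed.

Lemma laurentZ (W : lmodType k) (f : _ -> k^o) (w : W) :
  laurent f -> laurent (fun d => f d *: w).
Proof.
move=> [M HM]; exists [seq (x.1 *: w, x.2) | x <- M] => d d0.
rewrite HM // big_map scaler_suml; apply: eq_bigr => x _ /=.
by rewrite scalerA.
Qed.

Lemma laurent_sum (W : lmodType k) (T : finType) (F : T -> _ -> W) :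
  (forall j, laurent (F j)) -> laurent (fun d => \sum_j F j d).
Proof.
move=> HF; rewrite (_ : (fun d => _) = \sum_j F j); last by rewrite fct_sumE.
elim/big_ind: _ => // [|f h]; [exact: (laurent_cst 0) | exact: laurentD].
Qed.

Lemma laurentM (f h : _ -> k^o) :
  laurent f -> laurent h -> laurent (fun d => (f d : k) * h d : k^o).
Proof.
move=> [M HM] [N HN].
pose mulx (x y : k^o * {ffun 'I_r -> int}) : k^o * {ffun 'I_r -> int} :=
  ((x.1 : k) * y.1, [ffun i => x.2 i + y.2 i]).
exists [seq mulx x y | x <- M, y <- N] => d d0.
rewrite big_allpairs_dep HM // HN // mulr_suml; apply: eq_bigr => x _.
rewrite mulr_sumr; apply: eq_bigr => y _ /=.
by rewrite monomialD // [RHS]mulrACA.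
Qed.

Lemma laurent_ext (W : lmodType k) (f h : _ -> W) :
  (forall d, (forall i, d 0 i != 0) -> f d = h d) -> laurent h -> laurent f.
Proof. by move=> fh [M HM]; exists M => d d0; rewrite fh // HM. Qed.

Lemma diag_lfunV d : (forall i, d 0 i != 0) ->
  ((diag_lfun d)^-1)%VF = diag_lfun (\row_i (d 0 i)^-1).
Proof.
move=> d0; have g0 : GL (diag_lfun d) by apply: diag_set_sub; exists d.
rewrite -[LHS]comp_lfun1r -(diag_lfun_inv d0) comp_lfunA.
by rewrite lker0_compVf // comp_lfun1l.
Qed.

Fact diag_lfun_linear : linear (@diag_lfun k r).
Proof.
move=> c d e; apply/lfunP => v.
by rewrite add_lfunE scale_lfunE !diag_lfunE linearP mulmxDr scalemxAr.
Qed.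
HB.instance Definition _ :=
  GRing.isLinear.Build k _ _ _ (@diag_lfun k r) diag_lfun_linear.

Lemma laurent_linear (W W' : lmodType k) (l : {linear W -> W'}) (f : _ -> W) :
  laurent f -> laurent (fun d => l (f d)).
Proof.
move=> [M HM]; exists [seq (l x.1, x.2) | x <- M] => d d0.
rewrite HM // big_map linear_sum; apply: eq_bigr => x _.
by rewrite linearZ.
Qed.

Lemma laurent_row (f : 'I_r -> _ -> k^o) :
  (forall i, laurent (f i)) -> laurent (fun d => \row_i f i d : 'rV[k]_r).
Proof.
move=> Hf; apply: (@laurent_ext _ _ (fun d => \sum_i f i d *: delta_mx 0 i)) => [d _|].
  by rewrite [LHS]row_sum_delta; apply: eq_bigr => i _; rewrite mxE.
by apply: laurent_sum => i; exact: laurentZ.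
Qed.

(** A linear form in the pair (g, g^-1) splits into a form in g and one in g^-1; on the torus these
    involve only the exponents 1 and -1. Sums and products stay Laurent. *)
Lemma laurent_polyfun (p : 'End('rV[k]_r) * 'End('rV[k]_r) -> k^o) :
  polyfun p -> laurent (fun d => p (diag_lfun d, ((diag_lfun d)^-1)%VF)).
Proof.
elim=> [c|l|f h _ Hf _ Hh|f h _ Hf _ Hh].
- exact: laurent_cst.
- have Lexp (w : int) : laurent (fun d => diag_lfun (\row_i d 0 i ^ w)).
    apply: (@laurent_linear _ _ (@diag_lfun k r)); apply: laurent_row => i.
    exact: laurent_exp.
  have l0r (a b : 'End('rV[k]_r)) : l (a, b) = l (a, 0) + l (0, b).
    by rewrite -linearD; congr (l (_, _)); rewrite ?addr0 ?add0r.
  apply: (@laurent_ext _ _ (fun d => l (diag_lfun (\row_i d 0 i ^ 1), 0) +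
      l (0, diag_lfun (\row_i d 0 i ^ (-1))))) => [d d0|].
    rewrite diag_lfunV // l0r; congr (l (diag_lfun _, 0) + l (0, diag_lfun _)).
    by apply/rowP => i; rewrite mxE.
  have pl_lin : linear (fun a : 'End('rV[k]_r) => (a, 0 : 'End('rV[k]_r))).
    by move=> c a b; congr (_, _); rewrite /= ?scaler0 ?addr0.
  have pr_lin : linear (fun a : 'End('rV[k]_r) => (0 : 'End('rV[k]_r), a)).
    by move=> c a b; congr (_, _); rewrite /= ?scaler0 ?addr0.
  pose pl : {linear 'End('rV[k]_r) -> _} :=
    HB.pack (fun a => (a, 0)) (GRing.isLinear.Build _ _ _ _ _ pl_lin).
  pose pr : {linear 'End('rV[k]_r) -> _} :=
    HB.pack (fun a => (0, a)) (GRing.isLinear.Build _ _ _ _ _ pr_lin).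
  apply: laurentD.
    by apply: (@laurent_linear _ _ (l \o pl)); exact: Lexp.
  by apply: (@laurent_linear _ _ (l \o pr)); exact: Lexp.
- exact: laurentD.
- exact: laurentM.
Qed.

End LaurentSums.

(** Used to extract from a spanning list of eigenvectors a basis that still consists of
    eigenvectors. *)
Lemma span_basis_subset (k : fieldType) (V : vectType k) (X : seq V) :
  exists Y : seq V, [/\ {subset Y <= X}, free Y & (<<Y>> = <<X>>)%VS].
Proof.
elim: X => [|v X [Y [YX freeY spanY]]].
  by exists [::]; split=> //; rewrite nil_free.
have [vY|vY] := boolP (v \in <<Y>>%VS).
  exists Y; split=> // [y /YX yX|]; first by rewrite inE yX orbT.
  by rewrite span_cons -spanY; apply/esym/addv_idPr; rewrite -memvE.
exists (v :: Y); split; last by rewrite !span_cons spanY.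
  by move=> y; rewrite !inE => /predU1P[->|/YX ->]; rewrite ?eqxx ?orbT.
by rewrite free_cons vY.
Qed.

Section Torus.
Variables (k : closedFieldType) (V : vectType k).
Hypothesis char0 : [pchar k] =i pred0.

Lemma expz2_inj : injective (fun w : int => (2 : k) ^ w).
Proof.
have two_neq0 : (2 : k) != 0 by move/pcharf0P: char0 => ->.
move=> a b E; apply/eqP; rewrite -subr_eq0; apply/eqP/(exp2_eq1 char0).
by rewrite expfzDr // -invr_expz -E mulfV // expfz_neq0.
Qed.

Lemma laurent_alg_morphism r (G : GLsubgroup V) (psi : 'End('rV[k]_r) -> 'End(V)) :
  alg_morphism (diag_torus k r) G psi -> laurent (fun d => psi (diag_lfun d)).
Proof.
case=> _ _ psi_reg; set b := vbasis (fullv : {vspace 'End(V)}).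
apply: (@laurent_ext _ _ _ _
  (fun d => \sum_i (coord b i (psi (diag_lfun d)) : k^o) *: b`_i)).
  by move=> d _; apply: coord_vbasis; rewrite memvf.
apply: laurent_sum => i; apply: laurentZ.
have l_lin : linear (fun a : 'End(V) => coord b i a : k^o) by move=> c x y; rewrite linearP.
pose l : {linear 'End(V) -> k^o} :=
  HB.pack (fun a => coord b i a : k^o) (GRing.isLinear.Build _ _ _ _ _ l_lin).
have [p pp pE] := psi_reg l.
apply: (laurent_ext _ (laurent_polyfun pp)) => d d0.
by rewrite -pE //; exists d.
Qed.

(** The parametrization of [G] is a Laurent polynomial, so on the powers of a generic [g] it is a
    sum of exponentials with distinct bases [U s]. Polynomials in [g] then recover, by
    interpolation, both the weight projectors and every element of [G]; hence a vector fixed by [g]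
    is fixed by [G]. *)
Lemma torus_eigenbasis (G : GLsubgroup V) :
  is_torus G -> (forall v, (forall g, G g -> g v = v) -> v = 0) ->
  exists (n : nat) (e : n.-tuple V) (g : 'End(V)) (m : 'I_n -> int),
    [/\ basis_of fullv e, G g, forall i : 'I_n, g e`_i = 2 ^ m i *: e`_i
      & forall i, m i != 0].
Proof.
move=> [_ [r [phi [psi [phiM psiM psiK _]]]]] fixG.
have [M psiE] := laurent_alg_morphism psiM.
case: psiM => psiG psi_mul _; case: phiM => phiD _ _.
(* The exponent 0 is added so that interpolation can also prescribe the value at [U 0 = 1]. *)
pose S := [ffun=> 0] :: undup [seq x.2 | x <- M].
have [m m_inj] := generic_pairing S.
pose pair (s : {ffun 'I_r -> int}) := \sum_i s i * m i.
pose U s : k := 2 ^ pair s.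
have U_inj : {in S &, injective U}.
  by move=> s t sS tS /expz2_inj; exact: m_inj.
have MS x : x \in M -> x.2 \in S.
  by move=> xM; rewrite inE mem_undup map_f ?orbT.
have two_neq0 : (2 : k) != 0 by move/pcharf0P: char0 => ->.
(* The [j]-th power of the value at 2 of the one-parameter subgroup with exponents [m]. *)
pose dd j : 'rV[k]_r := \row_i (2 ^ m i) ^+ j.
have dd_neq0 j i : dd j 0 i != 0 by rewrite mxE expf_neq0 // expfz_neq0.
have diag_dd j : diag_torus k r (diag_lfun (dd j)) by exists (dd j).
have monomial_dd s j : monomial s (dd j) = U s ^+ j.
  rewrite /monomial /U /pair [RHS]exprnP exprz_exp mulr_suml.
  rewrite (big_morph (fun w : int => (2 : k) ^ w) (id1 := 1) (op1 := *%R)) //; last first.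
    by move=> a b; rewrite expfzDr.
  apply: eq_bigr => i _; rewrite mxE !exprnP !exprz_exp; congr (_ ^ _).
  by rewrite mulrC mulrA.
pose g := psi (diag_lfun (dd 1)).
have iter_g j v : iter j g v = psi (diag_lfun (dd j)) v.
  elim: j => [|j IH] /=.
    have -> : dd 0%N = const_mx 1 by apply/rowP => i; rewrite !mxE.
    (* Morphisms are only required to be multiplicative, so [psi] of the identity is known to be
       idempotent; being injective, it is the identity. *)
    rewrite diag_lfun1; have id_D : diag_torus k r \1%VF by exact: GLset1.
    have /lker0P := GLset_sub (psiG _ id_D); apply.
    by rewrite -comp_lfunE -psi_mul // comp_lfun1l.
  rewrite IH -comp_lfunE -psi_mul // diag_lfunM; congr (psi (diag_lfun _) v).
  by apply/rowP => i; rewrite !mxE expr1 exprS.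
pose pg (p : {poly k}) v := \sum_(j < size p) p`_j *: iter j g v.
have pgE p v : pg p v = \sum_(x <- M) p.[U x.2] *: x.1 v.
  rewrite /pg; under eq_bigr => j _.
    rewrite iter_g psiE // sum_lfunE scaler_sumr.
    under eq_bigr => x _ do rewrite scale_lfunE monomial_dd scalerA.
    over.
  rewrite exchange_big; apply: eq_bigr => x _ /=.
  by rewrite -scaler_suml horner_coef.
(* At the identity all monomials equal 1, so the coefficients of [psi] sum to the identity. *)
have sumM v : v = \sum_(x <- M) x.1 v.
  rewrite -[LHS]/(iter 0 g v) iter_g psiE // sum_lfunE.
  by apply: eq_bigr => x _; rewrite scale_lfunE monomial_dd scale1r.
have g_pg p v : g (pg p v) = pg (p * 'X) v.
  have [->|p0] := eqVneq p 0; first by rewrite mul0r /pg size_poly0 !big_ord0 linear0.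
  rewrite /pg size_mulX // big_ord_recl coefMX /= scale0r add0r linear_sum.
  by apply: eq_bigr => j _; rewrite linearZ /= coefMX.
have fix_g v : g v = v -> v = 0.
  move=> gv; apply: fixG => h Gh; rewrite -(psiK h Gh).
  have [d d0 ->] := phiD h Gh.
  (* [p.[U s] = monomial s d] gives [p(g) = h], and [p.[1] = 1] as [U 0 = 1]. *)
  have [p Hp] := interpolation (fun s => monomial s d) U_inj.
  rewrite psiE // sum_lfunE.
  transitivity (pg p v).
    rewrite pgE big_seq [RHS]big_seq; apply: eq_bigr => x xM.
    by rewrite scale_lfunE Hp // MS.
  rewrite /pg.
  have iter_v j : iter j g v = v by elim: j => //= j ->.
  under eq_bigr => j _ do rewrite iter_v.
  have := Hp [ffun=> 0]; rewrite inE eqxx monomial0 => /(_ isT).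
  rewrite /U /pair big1 => [|i _]; last by rewrite ffunE mul0r.
  rewrite expr0z horner_coef -scaler_suml.
  under eq_bigr => j _ do rewrite expr1n mulr1.
  by move=> ->; rewrite scale1r.
(* The Lagrange polynomial [lag s], evaluated at [g], is the sum of the coefficients of exponent
   [s]. Its image consists of eigenvectors for [U s], and these operators sum to the identity, so
   their values on a basis span [V]. *)
pose T := undup [seq x.2 | x <- M].
have lagP s : exists p : {poly k}, forall t, t \in S -> p.[U t] = (t == s)%:R.
  exact: interpolation.
have [lag Hlag] := choice lagP.
pose X := [seq pg (lag s) v | s <- T, v <- vbasis (fullv : {vspace V})].
have eigX w : w \in X -> exists w' : int, g w = 2 ^ w' *: w.
  case/allpairsP => -[s v] [/= sT _ ->]; exists (pair s).
  rewrite g_pg !pgE scaler_sumr big_seq [RHS]big_seq; apply: eq_bigr => x xM.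
  rewrite hornerM hornerX Hlag ?MS // scalerA -/(U s) mulrC.
  by case: eqP => [->|_]; rewrite ?mulr0.
have spanX : (<<X>> = fullv)%VS.
  apply/eqP; rewrite eqEsubv subvf /= -(span_basis (vbasisP fullv)).
  apply/span_subvP => v vb; rewrite [v]sumM.
  have -> : \sum_(x <- M) x.1 v = \sum_(s <- T) pg (lag s) v.
    under [RHS]eq_bigr => s _ do rewrite pgE.
    rewrite exchange_big /= big_seq [RHS]big_seq; apply: eq_bigr => x xM.
    rewrite -scaler_suml; under eq_bigr => s _ do rewrite Hlag ?MS //.
    rewrite (bigD1_seq x.2) ?undup_uniq ?mem_undup ?map_f //=.
    rewrite eqxx big1 ?addr0 ?scale1r //.
    by move=> s /negbTE; rewrite eq_sym => ->.
  rewrite big_seq; apply: rpred_sum => s sT; apply: memv_span.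
  by apply/allpairsP; exists (s, v).
have [Y [YX freeY spanY]] := span_basis_subset X.
exists (size Y), (in_tuple Y), g.
have /choice[w Hw] : forall i : 'I_(size Y), exists w : int, g Y`_i = 2 ^ w *: Y`_i.
  by move=> i; apply/eigX/YX/mem_nth.
exists w; split=> //.
- by rewrite basisEfree freeY spanY spanX subvv /= -spanX -spanY dim_span.
- exact: psiG.
- move=> i; apply/eqP => wi.
  have /fix_g Yi0 : g Y`_i = Y`_i by rewrite Hw wi expr0z scale1r.
  by have := free_not0 freeY (mem_nth 0 (ltn_ord i)); rewrite Yi0 eqxx.
Qed.

End Torus.

(** * Simplicity and grading *)

Section WordFiltration.
Variables (k : fieldType) (A : algType k) (I : Type) (gen : I -> A).

(** For the generators x_i and d_i of the Weyl algebra this is the Bernstein filtration. *)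
Inductive filt : nat -> A -> Prop :=
| filt1 n : filt n 1
| filt_lin n c a b : filt n a -> filt n b -> filt n (c *: a + b)
| filt_gen n i a : filt n a -> filt n.+1 (gen i * a).

Lemma filt0 n : filt n 0.
Proof. by rewrite -(addNr 1) -scaleN1r; apply: filt_lin; exact: filt1. Qed.

Lemma filtZ n c a : filt n a -> filt n (c *: a).
Proof. by move=> Fa; rewrite -[_ *: _]addr0; apply: filt_lin => //; exact: filt0. Qed.

Lemma filtD n a b : filt n a -> filt n b -> filt n (a + b).
Proof. by move=> Fa Fb; rewrite -[a]scale1r; exact: filt_lin. Qed.

Lemma filtS n a : filt n a -> filt n.+1 a.
Proof.
elim=> {n a} [n|n c a b _ Ha _ Hb|n i a _ Ha]; first exact: filt1.
  exact: filt_lin.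
exact: filt_gen.
Qed.

Lemma filt_le m n a : (m <= n)%N -> filt m a -> filt n a.
Proof.
move=> /subnKC <-; elim: (n - m)%N => [|d IH] Fa; first by rewrite addn0.
by rewrite addnS; apply/filtS/IH.
Qed.

Lemma filtM m n a b : filt m a -> filt n b -> filt (m + n) (a * b).
Proof.
move=> Fa Fb; elim: Fa => {m a} [m|m c a a' _ Ha _ Ha'|m i a _ Ha].
- by rewrite mul1r; apply: filt_le Fb; exact: leq_addl.
- by rewrite mulrDl -scalerAl; exact: filt_lin.
- by rewrite -mulrA addSn; exact: filt_gen.
Qed.

Hypothesis gen_span : forall a, exists n, filt n a.

Lemma commute_gen a : (forall i, gen i * a = a * gen i) -> forall b, b * a = a * b.
Proof.
move=> Ha b; have [n] := gen_span b.
elim=> {n b} [n|n c b b' _ Hb _ Hb'|n i b _ Hb]; first by rewrite mul1r mulr1.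
  by rewrite mulrDl mulrDr Hb' -scalerAl -scalerAr Hb.
by rewrite -mulrA Hb mulrA Ha mulrA.
Qed.

Variable om : I -> I -> k.
Hypothesis comm_gen : forall i j, gen i * gen j - gen j * gen i = (om i j)%:A.

(** Commutation with a generator is a derivation that sends each letter to a scalar, so it shortens
    words by one letter. The second conjunct covers [n = 0], where [n.-1] is not a drop. *)
Lemma filt_ad i n a :
  filt n a -> filt n.-1 (gen i * a - a * gen i) /\
              (n = 0 -> gen i * a - a * gen i = 0).
Proof.
elim=> {n a} [n|n c a b _ [Ha a0] _ [Hb b0]|n j a Fa [Ha a0]].
- by rewrite mulr1 mul1r subrr; split=> //; exact: filt0.
- have -> : gen i * (c *: a + b) - (c *: a + b) * gen i =
     c *: (gen i * a - a * gen i) + (gen i * b - b * gen i).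
    by rewrite mulrDr mulrDl -scalerAl -scalerAr opprD addrACA scalerBr.
  by split=> [|n0]; [exact: filt_lin | rewrite a0 // b0 // scaler0 addr0].
- split=> //=.
  have -> : gen i * (gen j * a) - gen j * a * gen i =
     om i j *: a + gen j * (gen i * a - a * gen i).
    rewrite -[om i j *: a]mul1r -scalerAr scalerAl -comm_gen mulrBl mulrBr !mulrA.
    by rewrite addrA subrK.
  apply: filt_lin => //.
  case: n Fa Ha a0 => [|n] Fa Ha a0; first by rewrite a0 // mulr0; exact: filt0.
  exact: filt_gen.
Qed.

Hypothesis central_scalar :
  forall a, (forall i, gen i * a = a * gen i) -> exists c, a = c%:A.

(* A nonzero element can be brought to a nonzero scalar by iterated commutators
   with the generators. *)
Lemma ad_stable_eq0 (J : A -> Prop) :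
  (forall i a, J a -> J (gen i * a - a * gen i)) ->
  (forall c, J c%:A -> c = 0) ->
  forall a, J a -> a = 0.
Proof.
move=> Jad J1 a Ja; have [n Fa] := gen_span a.
elim: n a Fa Ja => [|n IH] a Fa Ja.
  have /central_scalar[c ac] : forall i, gen i * a = a * gen i.
    by move=> i; apply/eqP; rewrite -subr_eq0 (filt_ad i Fa).2.
  by rewrite ac (J1 c) -?ac // scale0r.
have /central_scalar[c ac] : forall i, gen i * a = a * gen i.
  move=> i; apply/eqP; rewrite -subr_eq0; apply/eqP/IH; last exact: Jad.
  exact: (filt_ad i Fa).1.
by rewrite ac (J1 c) -?ac // scale0r.
Qed.

End WordFiltration.

Section Grading.
Variables (k : fieldType) (A : algType k) (I : Type) (gen : I -> A).
Variable wt : I -> int.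

(** [graded_zero] makes every weight space a subspace, including those of weights that no word
    attains. The sum of the weight spaces is not assumed direct. *)
Inductive graded : int -> A -> Prop :=
| graded1 : graded 0 1
| graded_lin w c a b : graded w a -> graded w b -> graded w (c *: a + b)
| graded_gen w i a : graded w a -> graded (wt i + w) (gen i * a)
| graded_zero w : graded w 0.

Lemma gradedZ w c a : graded w a -> graded w (c *: a).
Proof.
by move=> Ga; rewrite -[_ *: _]addr0; apply: graded_lin => //; exact: graded_zero.
Qed.

Lemma graded_decomp n a : filt gen n a ->
  exists2 l : seq (int * A), (forall x, x \in l -> graded x.1 x.2) &
    a = \sum_(x <- l) x.2.
Proof.
elim=> {n a} [n|n c a b _ [la Ga ->] _ [lb Gb ->]|n i a _ [l Gl ->]].
- exists [:: (0, 1)]; last by rewrite big_seq1.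
  by move=> x; rewrite inE => /eqP ->; exact: graded1.
- exists ([seq (x.1, c *: x.2) | x <- la] ++ lb).
    move=> x; rewrite mem_cat => /orP[/mapP[y /Ga Gy ->]|/Gb//].
    exact: gradedZ.
  by rewrite big_cat big_map scaler_sumr.
- exists [seq (wt i + x.1, gen i * x.2) | x <- l].
    by move=> x /mapP[y /Gl Gy ->]; exact: graded_gen.
  by rewrite big_map mulr_sumr.
Qed.

Variables (q : k) (sigma : A -> A).
Hypothesis q_neq0 : q != 0.
Hypothesis q_free : forall w : int, q ^ w = 1 -> w = 0.
Hypothesis sigma_lin : linear sigma.
Hypothesis sigma1 : sigma 1 = 1.
Hypothesis sigmaM : {morph sigma : a b / a * b}.
Hypothesis sigma_gen : forall i, sigma (gen i) = q ^ wt i *: gen i.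

Let sigma_isL := GRing.isLinear.Build _ _ _ _ sigma sigma_lin.
Let sigmaL : {linear A -> A} := HB.pack sigma sigma_isL.
Let sigma0 : sigma 0 = 0 := linear0 sigmaL.
Let sigmaD : {morph sigma : x y / x + y} := linearD sigmaL.
Let sigmaN : {morph sigma : x / - x} := linearN sigmaL.

Lemma sigma_graded w a : graded w a -> sigma a = q ^ w *: a.
Proof.
elim=> {w a} [|w c a b _ Ha _ Hb|w i a _ Ha|w].
- by rewrite sigma1 expr0z scale1r.
- by rewrite sigma_lin Ha Hb scalerDr !scalerA mulrC.
- by rewrite sigmaM sigma_gen Ha -scalerAl -scalerAr scalerA expfzDr.
- by rewrite sigma0 scaler0.
Qed.

(* Applying [(sigma - q ^ w) / (1 - q ^ w)] fixes [a] and removes the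
   component of weight [w]. *)
Lemma graded0_aux (l : seq (int * A)) a a0 :
  (forall x, x \in l -> graded x.1 x.2) -> graded 0 a0 -> sigma a = a ->
  a = a0 + \sum_(x <- l) x.2 -> graded 0 a.
Proof.
(* Induction on the length, since removing the head rescales all other components. A head of weight
   0 is absorbed into [a0]. *)
elim: {l}(size l) {-2}l (erefl (size l)) a0 => [|n IH] [|[w b] l] //= => [_|[sl]] a0 Gl Ga0 sa.
  by rewrite big_nil addr0 => ->.
rewrite big_cons /= addrA => aE.
have Gb : graded w b by apply: (Gl (w, b)); rewrite inE eqxx.
have Gl' x : x \in l -> graded x.1 x.2 by move=> xl; apply: Gl; rewrite inE xl orbT.
have [w0|w0] := eqVneq w 0.
  apply: (IH l sl (a0 + b)) => //.
  by rewrite -[a0]scale1r; apply: graded_lin => //; rewrite -w0.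
have u0 : 1 - q ^ w != 0.
  by rewrite subr_eq0 eq_sym; apply: contra_neq w0 => /q_free.
apply: (IH [seq (x.1, ((q ^ x.1 - q ^ w) / (1 - q ^ w)) *: x.2) | x <- l] _ a0) => //.
- by rewrite size_map.
- by move=> x /mapP[y /Gl' Gy ->]; exact: gradedZ.
- apply: (scalerI u0); rewrite big_map /= scalerDr scaler_sumr.
  under eq_bigr => x _ do rewrite scalerA mulrC divfK // scalerBl.
  rewrite sumrB -scaler_sumr scalerBl scale1r.
  (* The powers of [q] are the eigenvalues of [sigma], so the rescaled sum is expressed through
     [sigma] of the unscaled one, which is [a - a0 - b]. *)
  have -> : \sum_(x <- l) q ^ x.1 *: x.2 = \sum_(x <- l) sigma x.2.
    by rewrite big_seq [RHS]big_seq; apply: eq_bigr => x /Gl' /sigma_graded ->.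
  have <- : sigma (\sum_(x <- l) x.2) = \sum_(x <- l) sigma x.2.
    exact: (linear_sum sigmaL).
  have -> : \sum_(x <- l) x.2 = a - a0 - b.
    by rewrite aE -[RHS]addrA -opprD [RHS]addrC addKr.
  rewrite !sigmaD !sigmaN sa (sigma_graded Ga0) (sigma_graded Gb) expr0z scale1r.
  rewrite !scalerBl scale1r !scalerBr.
  set qa := q ^ w *: a; set qa0 := _ *: a0; set qb := _ *: b.
  have -> : a - a0 - qb - (qa - qa0 - qb) = (a - a0) - (qa - qa0).
    by rewrite opprB addrA subrK.
  by rewrite opprB addrACA addKr [a0 + _]addrC subrK.
Qed.

Lemma invariant_graded0 n a : filt gen n a -> sigma a = a -> graded 0 a.
Proof.
move=> /graded_decomp[l Gl aE] sa; apply: (graded0_aux Gl (graded_zero 0) sa).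
by rewrite add0r.
Qed.

End Grading.

(** * Lowest weight modules *)

Section LowestWeightModule.
Variables (k : fieldType) (A : algType k) (I : finType) (gen : I -> A).
Variables (om : I -> I -> k) (wt : I -> int) (phi : A -> k^o).

(** Right translation of the argument is a left action. The submodule generated by [phi] is the
    quotient of [A] by the left ideal of all [a] with [phi (d * a) = 0] for every [d]. *)
Definition act (a : A) (psi : A -> k^o) : A -> k^o := fun d => psi (d * a).

(* The weight [N] part of the submodule generated by [phi] in the [A]-module
   of functions on [A] under [act]. *)
Inductive level : int -> (A -> k^o) -> Prop :=
| level_vac : level 0 phi
| level0 N : level N 0
| level_lin N c f h : level N f -> level N h -> level N (c *: f + h)
| level_up i N f : 0 < wt i -> level N f -> level (wt i + N) (act (gen i) f).

Hypothesis comm_gen : forall i j, gen i * gen j - gen j * gen i = (om i j)%:A.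
Hypothesis om_wt : forall i j, om i j != 0 -> wt i = - wt j.
Hypothesis wt_neq0 : forall i, wt i != 0.
Hypothesis phi_lin : linear phi.
Hypothesis phi_neg : forall i d, wt i < 0 -> phi (d * gen i) = 0.

Lemma level_linear N f : level N f -> linear f.
Proof.
elim=> {N f} [//|N|N c f h _ Hf _ Hh|i N f _ _ Hf] b x y.
- by rewrite [RHS](_ : _ = b *: 0 + 0) // scaler0 addr0.
- rewrite !fctE Hf Hh !scalerDr !scalerA mulrC -!addrA.
  by congr (_ + _); rewrite addrCA.
- by rewrite /act mulrDl -scalerAl Hf.
Qed.

Lemma act_lin a c f h : act a (c *: f + h) = c *: act a f + act a h.
Proof. by []. Qed.

Lemma act0 a : act a 0 = 0.
Proof. by []. Qed.

Lemma actM a b f : act (a * b) f = act a (act b f).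
Proof. by apply/funext => d; rewrite /act mulrA. Qed.

(** A generator of negative weight is moved inwards past the positive ones until it reaches [phi],
    which it kills. Each exchange costs a scalar [om i j], nonzero only for opposite weights, so the
    extra term stays in the right level. *)
Lemma level_gen i N f : level N f -> level (wt i + N) (act (gen i) f).
Proof.
have [wi|wi Lf] := ltrP (wt i) 0; last first.
  by apply: level_up => //; rewrite lt_neqAle eq_sym wt_neq0.
elim=> {N f} [|N|N c f h _ Hf _ Hh|j N f wj Lf Hf].
- rewrite (_ : act _ _ = 0); first exact: level0.
  by apply/funext => d; rewrite /act phi_neg.
- exact: level0.
- by rewrite act_lin; exact: level_lin.
- have -> : act (gen i) (act (gen j) f) =
            om i j *: f + act (gen j) (act (gen i) f).
    apply/funext => d; rewrite /act !fctE -!mulrA.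
    have -> : gen i * gen j = (om i j)%:A + gen j * gen i by rewrite -comm_gen subrK.
    by rewrite mulrDr -scalerAr mulr1 (level_linear Lf).
  have Lu : level (wt i + (wt j + N)) (act (gen j) (act (gen i) f)).
    by rewrite addrCA; exact: level_up.
  have [->|/om_wt wij] := eqVneq (om i j) 0; first by rewrite scale0r add0r.
  by apply: level_lin => //; rewrite wij addKr.
Qed.

Lemma level_graded w a N f :
  graded gen wt w a -> level N f -> level (w + N) (act a f).
Proof.
move=> Ga Lf; elim: Ga => {w a} [|w c a b _ Ha _ Hb|w i a _ Ha|w].
- by rewrite add0r (_ : act _ _ = f) //; apply/funext => d; rewrite /act mulr1.
- rewrite (_ : act _ _ = c *: act a f + act b f); first exact: level_lin.
  by apply/funext => d; rewrite /act mulrDr -scalerAr (level_linear Lf).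
- by rewrite actM -addrA; exact: level_gen.
- rewrite (_ : act _ _ = 0); first exact: level0.
  apply/funext => d; rewrite /act mulr0.
  by have := level_linear Lf (-1) 0 0; rewrite scaleN1r addNr scaleN1r addNr.
Qed.

(** Splitting off the outermost generator expresses a level through strictly lower ones, apart from
    a multiple of [phi] that occurs only in level 0. This is the recursion behind [level_fin]. *)
Lemma level_decomp N f : level N f -> exists c (h : I -> A -> k^o),
  [/\ N != 0 -> c = 0, forall i, level (N - wt i) (h i) &
      f = c *: phi + \sum_(i | 0 < wt i) act (gen i) (h i)].
Proof.
elim=> {N f} [|N|N c f h _ [cf [uf [f0 Lf ->]]] _ [ch [uh [h0 Lh ->]]]|i N f wi Lf _].
- exists 1, (fun=> 0); split=> // [i|]; first exact: level0.
  by rewrite big1 ?addr0 ?scale1r // => i _.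
- exists 0, (fun=> 0); split=> // [i|]; first exact: level0.
  by rewrite big1 ?addr0 ?scale0r // => i _.
- exists (c * cf + ch), (fun i => c *: uf i + uh i); split=> [N0|i|].
  + by rewrite f0 // h0 // mulr0 addr0.
  + exact: level_lin.
  + rewrite (eq_bigr _ (fun i _ => act_lin (gen i) c (uf i) (uh i))).
    rewrite big_split -scaler_sumr /= scalerDl -scalerA scalerDr -!addrA.
    by congr (_ + _); rewrite addrCA.
- exists 0, (fun j => if j == i then f else 0); split=> // [j|].
    by case: eqP => [->|_]; [rewrite addrAC subrr add0r | exact: level0].
  rewrite scale0r add0r (bigD1 i) //= eqxx big1 ?addr0 // => j /andP[_ /negbTE ->].
  exact: act0.
Qed.

Lemma level_neg N f : level N f -> N < 0 -> f = 0.
Proof.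
elim=> {N f} [//|//|N c f h _ Hf _ Hh N0|i N f wi _ Hf N0].
  by rewrite Hf // Hh // scaler0 addr0.
by rewrite Hf ?act0 //; apply: lt_trans N0; rewrite ltrDr.
Qed.

(** Negative levels vanish, and splitting off a generator of positive weight lowers the level by at
    least 1, so induction on an upper bound [b] of the level applies. *)
Lemma level_fin N : exists (T : finType) (e : T -> A -> k^o),
  (forall t, level N (e t)) /\
  forall f, level N f -> exists c : T -> k, f = \sum_t c t *: e t.
Proof.
have [b] : exists b : nat, (N < b%:Z)%R 
    by exists `|N|%N.+1; rewrite intS ltz1D abszE ler_norm.
elim: b N => [|b IH] N Nb.
  exists void, (fun=> 0); split=> [t|f /level_neg -> //]; first exact: level0.
  by exists (fun=> 0); rewrite big1 // => -[].
have {}IH (i : I) : exists (T : finType) (e : T -> A -> k^o),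
    (forall t, level (N - wt i) (e t)) /\
    (0 < wt i -> forall f, level (N - wt i) f ->
       exists c : T -> k, f = \sum_t c t *: e t).
  have [wi|wi] := ltrP 0 (wt i); last first.
    by exists void, (fun=> 0); split=> [t|]; [exact: level0 | ].
  have [|T [e [Le He]]] := IH (N - wt i); last by exists T, e.
  by rewrite ltrBlDr; apply: lt_le_trans Nb _; rewrite intS addrC lerD2l -gtz0_ge1.
have [T HT] := choice IH; pose e i := sval (cid (HT i)).
have He i : (forall t, level (N - wt i) (e i t)) /\ (0 < wt i ->
    forall f, level (N - wt i) f -> exists c : T i -> k, f = \sum_t c t *: e i t).
  exact: svalP (cid (HT i)).
(* The spanning family consists of [phi], when [N] is 0, and of the images under each positive
   generator of the family of the lower level. Generators of negative weight contribute 0. *)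
pose up i (t : T i) := if 0 < wt i then act (gen i) (e i t) else 0.
pose h (t : unit + {i : I & T i}) := match t with
  | inl _ => if N == 0 then phi else 0
  | inr t => up _ (tagged t)
  end.
exists (unit + {i : I & T i})%type, h; split.
  move=> [_|[i t]] /=.
    by case: eqP => [->|_]; [exact: level_vac|exact: level0].
  rewrite /up; case: ifP => wi; last exact: level0.
  rewrite -[N](subrK (wt i)) addrC; apply: level_up => //.
  exact: (He i).1.
move=> f /level_decomp[c [u [c0 Lu ->]]].
have Ev : forall i : I, exists v : T i -> k,
    0 < wt i -> u i = \sum_t v t *: e i t.
  move=> i; have [wi|wi] := ltrP 0 (wt i); last by exists (fun=> 0).
  by have [v ->] := (He i).2 wi (u i) (Lu i); exists v.
pose v i := sval (cid (Ev i)).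
have Hv i : 0 < wt i -> u i = \sum_t v i t *: e i t by exact: svalP (cid (Ev i)).
exists (fun t => match t with inl _ => c | inr t => v _ (tagged t) end).
rewrite big_sumType (big_pred1 tt) /=; last by case.
rewrite -(sig_big_dep xpredT (fun _ => xpredT) (fun i t => v i t *: up i t)) /=.
congr (_ + _); first by case: eqP => // /eqP /c0 ->; rewrite !scale0r.
rewrite big_mkcond; apply: eq_bigr => i _; rewrite /up; case: ifP => wi; last first.
  by rewrite big1 // => t _; rewrite scaler0.
by rewrite Hv //; apply/funext => d; rewrite /act !fct_sumE.
Qed.

End LowestWeightModule.

Section LevelModule.
Variables (k : fieldType) (A : algType k) (I : finType) (gen : I -> A).
Variables (om : I -> I -> k) (wt : I -> int) (phi : A -> k^o).

Hypothesis comm_gen : forall i j, gen i * gen j - gen j * gen i = (om i j)%:A.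
Hypothesis om_wt : forall i j, om i j != 0 -> wt i = - wt j.
Hypothesis wt_neq0 : forall i, wt i != 0.
Hypothesis phi_lin : linear phi.
Hypothesis phi_neg : forall i d, wt i < 0 -> phi (d * gen i) = 0.

Variables (B : algType k) (iota : {lrmorphism B -> A}).
Hypothesis iota0 : forall b, graded gen wt 0 (iota b).
Variable N : int.

Definition level_pred : {pred (A -> k^o)} := fun f => `[< level gen wt phi N f >].

Lemma level_submod : submod_closed level_pred.
Proof.
split=> [|c f h /asboolP Lf /asboolP Lh]; apply/asboolP; first exact: level0.
exact: level_lin.
Qed.
HB.instance Definition _ :=
  GRing.isSubmodClosed.Build k (A -> k^o) level_pred level_submod.

Definition level_mod := {f : A -> k^o | f \in level_pred}.
HB.instance Definition _ := SubChoice.on level_mod.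
HB.instance Definition _ :=
  GRing.SubChoice_isSubZmodule.Build (A -> k^o) level_pred level_mod
    (GRing.submod_closedB level_submod).

Fact act_iota_level (b : B) (f : level_mod) : act (iota b) (val f) \in level_pred.
Proof.
apply/asboolP; rewrite -[N]add0r.
apply: (level_graded comm_gen om_wt wt_neq0 phi_lin phi_neg) => //.
exact/asboolP/(valP f).
Qed.

Definition level_scale (b : B) (f : level_mod) : level_mod :=
  exist _ (act (iota b) (val f)) (act_iota_level b f).

Lemma level_mod_linear (f : level_mod) : linear (val f).
Proof. exact/(level_linear phi_lin)/asboolP/(valP f). Qed.

Fact level_scaleA a b f : level_scale a (level_scale b f) = level_scale (a * b) f.
Proof. by apply/val_inj; rewrite /= rmorphM actM. Qed.
Fact level_scale1 : left_id 1 level_scale.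
Proof. by move=> f; apply/val_inj/funext => d; rewrite /= /act rmorph1 mulr1. Qed.
Fact level_scaleDr : right_distributive level_scale +%R.
Proof. by move=> b f h; apply/val_inj. Qed.
Fact level_scaleDl f : {morph level_scale^~ f : a b / a + b}.
Proof.
move=> a b; apply/val_inj/funext => d; rewrite /= /act rmorphD mulrDr.
by have := level_mod_linear f 1 (d * iota a) (d * iota b); rewrite !scale1r.
Qed.

Definition level_lmod : lmodType B :=
  HB.pack level_mod (GRing.Zmodule_isLmodule.Build B level_mod
    level_scaleA level_scale1 level_scaleDr level_scaleDl).

Lemma level_lmod_fd : finite_dimensional level_lmod.
Proof.
have [T [e [Le He]]] := level_fin gen wt phi N.
have Pe t : e t \in level_pred by exact/asboolP.
exists #|T|, (fun i => exist _ (e (enum_val i)) (Pe (enum_val i)) : level_lmod).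
move=> f; have [c fE] := He (val f) (asboolP _ (valP f)).
exists (c \o enum_val); apply/val_inj.
have valS (F : 'I_#|T| -> level_mod) : val (\sum_i F i) = \sum_i val (F i).
  exact: (raddf_sum (val : level_mod -> _)).
rewrite valS fE (big_enum_val (A := T)); apply: eq_bigr => i _.
(* The scalar [c%:A] of [B] acts by multiplying the argument by [c]; by linearity this is
   multiplication of the value. *)
apply/funext => d; rewrite /= /act rmorph_alg -scalerAr mulr1.
have elin := level_linear phi_lin (Le (enum_val i)).
have e0 : e (enum_val i) 0 = 0.
  by have := elin (-1) 0 0; rewrite scaleN1r addNr scaleN1r addNr.
by rewrite -[_ *: d]addr0 elin e0 addr0.
Qed.

End LevelModule.

(** The [a] with [phi (d * a * c) = 0] for all [d] and [c] form a two-sided ideal, which contains no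
    nonzero scalar since [phi 1 = 1]; [ad_stable_eq0] makes it zero. An element of [B] that kills
    all level modules maps into this ideal. *)
Theorem enough_fd_graded0 (k : fieldType) (A : algType k) (I : finType)
    (gen : I -> A) (om : I -> I -> k) (wt : I -> int) (phi : A -> k^o)
    (B : algType k) (iota : {lrmorphism B -> A}) :
  (forall i j, gen i * gen j - gen j * gen i = (om i j)%:A) ->
  (forall i j, om i j != 0 -> wt i = - wt j) ->
  (forall i, wt i != 0) ->
  (forall a, exists n, filt gen n a) ->
  (forall a, (forall i, gen i * a = a * gen i) -> exists c, a = c%:A) ->
  linear phi -> phi 1 = 1 ->
  (forall i d, wt i < 0 -> phi (d * gen i) = 0) ->
  injective iota -> (forall b, graded gen wt 0 (iota b)) ->
  enough_fd_modules B.
Proof.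
move=> comm_gen om_wt wt_neq0 gen_span central phi_lin phi1 phi_neg iota_inj iota0.
apply/seteqP; split=> [b Hb /=|_ -> M _ m]; last by rewrite scale0r.
have phi0 : phi 0 = 0.
  by have := phi_lin (-1) 0 0; rewrite scaleN1r addNr scaleN1r addNr.
have phiB x y : phi (x - y) = phi x - phi y.
  by rewrite addrC -scaleN1r phi_lin scaleN1r addrC.
have phiD x y : phi (x + y) = phi x + phi y.
  by rewrite -[x]scale1r phi_lin !scale1r.
have kill N f d : level gen wt phi N f -> f (d * iota b) = 0.
  move=> Lf; have Pf : f \in level_pred gen wt phi N by apply/asboolP.
  have /(congr1 (fun h => val (h : level_mod gen wt phi N) d)) := Hb _
    (level_lmod_fd comm_gen om_wt wt_neq0 phi_lin phi_neg iota0 N)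
    (exist _ f Pf : level_mod gen wt phi N).
  by [].
apply: iota_inj; rewrite rmorph0.
apply: (ad_stable_eq0 gen_span comm_gen central
          (J := fun a => forall d c, phi (d * a * c) = 0)).
- move=> i a Ja d c; rewrite mulrBr mulrBl phiB !mulrA -[d * a * gen i * c]mulrA.
  by rewrite !Ja subrr.
- move=> c /(_ 1 1); rewrite mul1r mulr1 -[_ *: 1]addr0 phi_lin phi0 phi1 addr0.
  by rewrite [LHS]mulr1.
(* By linearity [c] may be taken homogeneous; then [act c phi] lies in a single level, where
   [iota b] acts as 0. *)
- move=> d c; have [n /(graded_decomp wt)[l Gl ->]] := gen_span c.
  rewrite mulr_sumr big_seq; elim/big_ind: _ => // [x y|x /Gl Gx].
    by rewrite phiD => -> ->; rewrite addr0.
  apply: (kill x.1 (act x.2 phi)); rewrite -[x.1]addr0.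
  have := level_graded comm_gen om_wt wt_neq0 phi_lin phi_neg Gx (level_vac gen wt phi).
  by [].
Qed.

(** * The functional [phi] *)

Section Ad.
Variables (k : fieldType) (A : algType k).

Definition ad (x d : A) : A := x * d - d * x.

Fact ad_linear x : linear (ad x).
Proof.
move=> c a b; rewrite /ad mulrDr mulrDl -scalerAl -scalerAr opprD addrACA.
by rewrite scalerBr.
Qed.
HB.instance Definition _ x := GRing.isLinear.Build k A A _ (ad x) (ad_linear x).

Lemma iter_ad_linear x m : linear (iter m (ad x)).
Proof. by move=> c a b; elim: m => //= m ->; rewrite linearP. Qed.

Lemma iter_ad_mull x c m d : x * c = c * x ->
  iter m (ad x) (c * d) = c * iter m (ad x) d.
Proof.
by move=> xc; elim: m => //= m ->; rewrite /ad mulrBr !mulrA xc.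
Qed.

Lemma iter_ad_mulr x c m d : x * c = c * x ->
  iter m (ad x) (d * c) = iter m (ad x) d * c.
Proof.
by move=> xc; elim: m => //= m ->; rewrite /ad mulrBl -!mulrA xc.
Qed.

Lemma iter_ad1 x m : iter m.+1 (ad x) 1 = 0.
Proof.
by elim: m => [|m /= ->]; rewrite /= /ad ?mulr1 ?mul1r ?mulr0 ?mul0r subrr.
Qed.

End Ad.

Section Flip.
Variables (k : fieldType) (A : algType k) (x p : A) (phi : A -> k^o).
Hypothesis char0 : [pchar k] =i pred0.
Hypothesis ccr : p * x - x * p = 1.
Hypothesis p_nil : forall d, exists M, forall m, (M <= m)%N -> iter m (ad p) d = 0.
Hypothesis phi_lin : linear phi.

Definition flip_term m d : k :=
  (m`!%:R)^-1 * phi (iter m (ad x) (iter m (ad p) d)).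

(* Formally [phi \o exp (ad x * ad p)], a finite sum on each [d] since [ad p] is
   locally nilpotent: it turns normal into antinormal ordering. *)
Definition flip d : k^o := \sum_(m < sval (cid (p_nil d))) flip_term m d.

Let phi0 : phi 0 = 0.
Proof. by have := phi_lin (-1) 0 0; rewrite scaleN1r addNr scaleN1r addNr. Qed.

Let iter_ad0 y m : iter m (ad y) 0 = 0 :> A.
Proof. by elim: m => //= m ->; rewrite linear0. Qed.

(** The truncation chosen in [flip] is immaterial, as the terms beyond any valid bound vanish. This
    allows a common bound for several arguments. *)
Lemma flipE d M N : (forall m, (M <= m)%N -> iter m (ad p) d = 0) -> (M <= N)%N ->
  flip d = \sum_(m < N) flip_term m d.
Proof.
move=> dM MN; rewrite /flip; case: cid => M' /= dM'.
have E N1 N2 : (forall m, (N1 <= m)%N -> iter m (ad p) d = 0) ->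
    \sum_(m < N1) flip_term m d = \sum_(m < N1 + N2) flip_term m d.
  move=> dN; rewrite big_split_ord /= [X in _ + X]big1 ?addr0 // => m _.
  by rewrite /flip_term dN ?leq_addr // iter_ad0 phi0 mulr0.
rewrite (E _ N dM') addnC -E // => m Nm.
by rewrite dM // (leq_trans MN).
Qed.

Lemma flip_linear : linear flip.
Proof.
move=> c a b; have [Ma dMa] := p_nil a; have [Mb dMb] := p_nil b.
pose N := maxn Ma Mb.
rewrite (flipE dMa (leq_maxl _ Mb)) (flipE dMb (leq_maxr Ma _)).
rewrite (@flipE (c *: a + b) N N) //.
  rewrite scaler_sumr -big_split /=; apply: eq_bigr => m _.
  rewrite /flip_term !iter_ad_linear phi_lin mulrDr; congr (_ + _).
  by rewrite [LHS]mulrCA.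
by move=> m; rewrite geq_max => /andP[am bm]; rewrite iter_ad_linear dMa // dMb // scaler0 addr0.
Qed.

Lemma flip1 : flip 1 = phi 1.
Proof.
rewrite (@flipE 1 1 1) => [|[|m] // _|//]; last exact: iter_ad1.
by rewrite big_ord1 /flip_term invr1 mul1r.
Qed.

Lemma flip_mull c : x * c = c * x -> p * c = c * p ->
  (forall d, phi (c * d) = 0) -> forall d, flip (c * d) = 0.
Proof.
move=> xc pc phic d; rewrite /flip big1 // => m _.
by rewrite /flip_term !iter_ad_mull // phic mulr0.
Qed.

Lemma flip_mulr c : x * c = c * x -> p * c = c * p ->
  (forall d, phi (d * c) = 0) -> forall d, flip (d * c) = 0.
Proof.
move=> xc pc phic d; rewrite /flip big1 // => m _.
by rewrite /flip_term !iter_ad_mulr // phic mulr0.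
Qed.

(** Leibniz rule for the derivation [ad p], which sends [x] to 1 and so kills it at the second
    application. For [m = 0] the factor [m%:R] makes the value of [m.-1] harmless. *)
Lemma iter_ad_ccr m d :
  iter m (ad p) (d * x) = iter m (ad p) d * x + m%:R *: iter m.-1 (ad p) d.
Proof.
elim: m => [|m IH] /=; first by rewrite scale0r addr0.
rewrite IH linearD linearZ /=.
have -> : ad p (iter m (ad p) d * x) = ad p (iter m (ad p) d) * x + iter m (ad p) d.
  move: (iter m _ d) => y; rewrite /ad -[X in _ = _ + X]mulr1 -ccr.
  by rewrite mulrBl mulrBr !mulrA addrA subrK.
rewrite -addrA; congr (_ + _); case: m {IH} => [|m] /=.
  by rewrite scale0r addr0 scale1r.
by rewrite -{1}[ad p _]scale1r -scalerDl -[1]/(1%:R) -natrD add1n.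
Qed.

(** As [phi] kills [x * b], one has [phi (b * x) = - phi (ad x b)]. With the Leibniz rule the [m]-th
    term becomes u_(m-1)/(m-1)! - u_m/m!, and the sum telescopes to its last term, which vanishes
    for large bounds. *)
Lemma flip_x : (forall d, phi (x * d) = 0) -> forall d, flip (d * x) = 0.
Proof.
move=> phix d.
have phixr b : phi (b * x) = - phi (ad x b).
  have -> : b * x = (-1) *: ad x b + x * b.
    by rewrite /ad scaleN1r opprB subrK.
  by rewrite phi_lin phix addr0 scaleN1r.
have nat_neq0 m : (m.+1%:R : k) != 0 by move/pcharf0P: char0 => ->.
pose u m : k := phi (iter m.+1 (ad x) (iter m (ad p) d)).
have telescope N : \sum_(m < N.+1) flip_term m (d * x) = - ((N`!%:R)^-1 * u N).
  have termE m : flip_term m (d * x) = (m`!%:R)^-1 *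
      (- u m + m%:R * phi (iter m (ad x) (iter m.-1 (ad p) d))).
    rewrite /flip_term iter_ad_ccr addrC iter_ad_linear phi_lin addrC.
    by rewrite iter_ad_mulr // phixr.
  elim: N => [|N IH]; first by rewrite big_ord1 termE mul0r addr0 mulrN.
  rewrite big_ord_recr /= IH termE mulrDr mulrN /= -/(u N) addrCA.
  have -> : (N.+1)`!%:R^-1 * (N.+1%:R * u N) = N`!%:R^-1 * u N.
    by rewrite factS natrM invfM mulrACA mulVf // mul1r.
  by rewrite addNr addr0.
have [M dM] := p_nil d; have [M' dM'] := p_nil (d * x).
rewrite (@flipE (d * x) M' (M + M').+1) //; last by rewrite ltnW // ltnS leq_addl.
by rewrite telescope /u dM ?leq_addr // iter_ad0 phi0 mulr0 oppr0.
Qed.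

End Flip.

(** The indices in [s] are flipped one at a time. Since [x j] and [p j] commute with the generators
    of the other indices, a flip at [j] preserves the vanishing conditions there. *)
Lemma exists_flipped (k : fieldType) (A : algType k) (I : eqType) (x p : I -> A)
    (phi : A -> k^o) (s : seq I) :
  [pchar k] =i pred0 ->
  (forall i, p i * x i - x i * p i = 1) ->
  (forall i j, i != j -> p i * x j = x j * p i) ->
  (forall i j, x i * x j = x j * x i) ->
  (forall i j, p i * p j = p j * p i) ->
  (forall i d, exists M, forall m, (M <= m)%N -> iter m (ad (p i)) d = 0) ->
  linear phi -> phi 1 = 1 ->
  (forall i d, phi (x i * d) = 0) -> (forall i d, phi (d * p i) = 0) ->
  exists psi : A -> k^o, [/\ linear psi, psi 1 = 1,
    forall i, i \in s -> forall d, psi (d * x i) = 0 &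
    forall i, i \notin s -> forall d, psi (d * p i) = 0].
Proof.
move=> char0 ccr px xx pp p_nil phi_lin phi1 phix phip.
(* The induction also carries the vanishing on [x i * d] for indices not yet flipped, which [flip_x]
   requires. *)
suff [psi [? ? ? Hp]] : exists psi : A -> k^o, [/\ linear psi, psi 1 = 1,
    forall i, i \in s -> forall d, psi (d * x i) = 0 &
    forall i, i \notin s ->
      (forall d, psi (x i * d) = 0) /\ (forall d, psi (d * p i) = 0)].
  by exists psi; split=> // i /Hp[].
elim: s => [|j s [psi [psi_lin psi1 psix psip]]].
  by exists phi; split=> // i _; split.
have [js|js] := boolP (j \in s).
  exists psi; split=> // i; rewrite inE; first by case: eqP => [-> _|_ /=]; exact: psix.
  by rewrite negb_or => /andP[_ /psip].
exists (flip (x j) psi (p_nil j)); split.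
- exact: flip_linear.
- by rewrite flip1.
- move=> i; rewrite inE; case: eqP => [-> _ d|/eqP ij /= is_ d].
    by apply: flip_x => //; case: (psip j js).
  by apply: flip_mulr; [exact: xx | rewrite px // eq_sym | exact: psix].
- move=> i; rewrite inE negb_or => /andP[ij /psip[Hx Hp]].
  split=> d; first by apply: flip_mull; [exact: xx | rewrite px // eq_sym | ].
  by apply: flip_mulr; [rewrite px | exact: pp | ].
Qed.

(** * The Weyl algebra *)

Section WeylGenerators.
Variables (k : closedFieldType) (V : vectType k).
Hypothesis char0 : [pchar k] =i pred0.

Implicit Types (f h : coordRing V) (D : endCoord V).

Lemma mulop_weyl f : mulop f \in @weyl_pred k V.
Proof. by apply/asboolP/gen_subalg_incl; left; exists f. Qed.

Lemma derivop_weyl v : derivop v \in @weyl_pred k V.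
Proof. by apply/asboolP/gen_subalg_incl; right; exists v. Qed.

Definition wmul f : weyl V := exist _ (mulop f) (mulop_weyl f).
Definition wder v : weyl V := exist _ (derivop v) (derivop_weyl v).

Lemma weyl_eqP (a b : weyl V) :
  (forall f (w : V), val (val (val a) f) w = val (val (val b) f) w) <-> a = b.
Proof.
split=> [H|-> //]; apply/val_inj/val_inj/funext => f; apply/val_inj/funext => w.
exact: H.
Qed.

Lemma dir_deriv_linear v w c (f : V -> k^o) : polyfun f -> forall u,
  dir_deriv (c *: v + w) f u = c * dir_deriv v f u + dir_deriv w f u.
Proof.
elim=> [b|l|{}f h pf Hf ph Hh|{}f h pf Hf ph Hh] u.
- by rewrite !dir_deriv_cst mulr0 addr0.
- by rewrite !dir_deriv_lin linearP.
- by rewrite !dir_derivD // Hf Hh mulrDr addrACA.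
- rewrite !dir_derivM // Hf Hh !mulrDr !mulrDl.
  by rewrite addrACA -mulrA (mulrCA _ c).
Qed.

Lemma wder_linear : linear wder.
Proof. by move=> c v w; apply/weyl_eqP => f u; exact: dir_deriv_linear (coordRingP f) u. Qed.
HB.instance Definition _ := GRing.isLinear.Build k V (weyl V) _ wder wder_linear.

Lemma wmul_linear : linear wmul.
Proof.
by move=> c f h; apply/val_inj/val_inj/funext => x /=; rewrite mulrDl -scalerAl.
Qed.
HB.instance Definition _ := GRing.isLinear.Build k (coordRing V) (weyl V) _ wmul wmul_linear.

Lemma wmulM f h : wmul (f * h) = wmul f * wmul h.
Proof. by apply/weyl_eqP => x u; rewrite /= mulrA. Qed.

Lemma wmul1 : wmul 1 = 1.
Proof. by apply/val_inj/val_inj/funext => x /=; rewrite mul1r. Qed.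

Definition lin_fun (l : {linear V -> k^o}) : coordRing V := mkCoord (polyfun_lin l).

Lemma dir_deriv_comm v w (f : V -> k^o) : polyfun f ->
  dir_deriv v (dir_deriv w f) = dir_deriv w (dir_deriv v f).
Proof.
elim=> [b|l|{}f h pf Hf ph Hh|{}f h pf Hf ph Hh].
- by rewrite !dir_deriv_cst.
- by rewrite !dir_deriv_lin !dir_deriv_cst.
- have pf' z : polyfun (dir_deriv z f) by exact: dir_deriv_polyfun.
  have ph' z : polyfun (dir_deriv z h) by exact: dir_deriv_polyfun.
  by rewrite !dir_derivD // Hf Hh.
- have pf' z : polyfun (dir_deriv z f) by exact: dir_deriv_polyfun.
  have ph' z : polyfun (dir_deriv z h) by exact: dir_deriv_polyfun.
  rewrite !dir_derivM // !dir_derivD; try exact: polyfun_mul.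
  rewrite !dir_derivM // Hf Hh; apply/funext => u.
  by rewrite addrACA [X in _ + X]addrC addrACA.
Qed.

Lemma wder_comm v w : wder v * wder w = wder w * wder v.
Proof.
apply/weyl_eqP => f u; apply: (congr1 (fun F => F u)).
exact: dir_deriv_comm (coordRingP f).
Qed.

Lemma wmul_comm f h : wmul f * wmul h = wmul h * wmul f.
Proof. by rewrite -!wmulM mulrC. Qed.

Lemma wder_wmul_lin v (l : {linear V -> k^o}) :
  wder v * wmul (lin_fun l) - wmul (lin_fun l) * wder v = (l v : k)%:A.
Proof.
apply/weyl_eqP => f u.
have -> : val (val (val (wder v * wmul (lin_fun l) - wmul (lin_fun l) * wder v)) f) u =
  dir_deriv v (fun w => (l w : k) * val f w) u - (l u : k) * dir_deriv v (val f) u by [].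
rewrite dir_derivM; [|exact: polyfun_lin|exact: coordRingP].
by rewrite dir_deriv_lin addrK.
Qed.

Variables (n : nat) (e : n.-tuple V).
Hypothesis e_basis : basis_of fullv e.

Definition coord_fun i : V -> k^o := coord e i.
Fact coord_fun_linear i : linear (coord_fun i).
Proof. by move=> c v w; rewrite /coord_fun linearP. Qed.
HB.instance Definition _ i :=
  GRing.isLinear.Build k V k^o _ (coord_fun i) (coord_fun_linear i).

Definition xop i := wmul (lin_fun (coord_fun i)).
Definition dop i := wder e`_i.
Definition wgen (t : 'I_n + 'I_n) := match t with inl i => xop i | inr i => dop i end.

Lemma basis_decomp v : v = \sum_(i < n) coord e i v *: e`_i.
Proof. by apply: coord_basis e_basis _; rewrite memvf. Qed.

Lemma lin_fun_decomp (l : {linear V -> k^o}) :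
  lin_fun l = \sum_(i < n) (l e`_i : k) *: lin_fun (coord_fun i).
Proof.
apply/val_inj/funext => v; rewrite (raddf_sum (val : coordRing V -> _)) /= fct_sumE.
rewrite [in LHS](basis_decomp v) linear_sum; apply: eq_bigr => i _.
by rewrite linearZ /=; exact: mulrC.
Qed.

Let filt_gen0 i : filt wgen 1 (wgen i).
Proof. by rewrite -[wgen i]mulr1; apply/filt_gen/filt1. Qed.

Let filt_sum m (T : finType) (F : T -> weyl V) :
  (forall i, filt wgen m (F i)) -> filt wgen m (\sum_i F i).
Proof.
move=> HF; elim/big_ind: _ => //; first exact: filt0.
by move=> a b; exact: filtD.
Qed.

(** A linear form is a combination of coordinates, of degree 1; products add the degrees and sums
    take the maximum. *)
Lemma filt_wmul f : exists m, filt wgen m (wmul f).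
Proof.
suff H phi : polyfun phi -> forall h, val h = phi -> exists m, filt wgen m (wmul h).
  exact: (H (val f) (coordRingP f)).
elim=> {phi} [c|l|phi psi pphi IHphi ppsi IHpsi|phi psi pphi IHphi ppsi IHpsi] h hE.
- exists 0%N; have -> : h = c *: 1.
    by apply/val_inj; rewrite hE; apply/funext => v; exact: esym (mulr1 _).
  by rewrite linearZ /= wmul1; apply/filtZ/filt1.
- exists 1%N; have -> : h = lin_fun l by exact: val_inj.
  rewrite lin_fun_decomp linear_sum; apply: filt_sum => i.
  by rewrite linearZ; apply: filtZ; exact: (filt_gen0 (inl i)).
- have [m Fm] := IHphi (mkCoord pphi) erefl.
  have [m' Fm'] := IHpsi (mkCoord ppsi) erefl.
  exists (maxn m m'); have -> : h = mkCoord pphi + mkCoord ppsi by exact: val_inj.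
  rewrite linearD.
  by apply: filtD; [apply: filt_le Fm | apply: filt_le Fm']; rewrite leq_max leqnn ?orbT.
- have [m Fm] := IHphi (mkCoord pphi) erefl.
  have [m' Fm'] := IHpsi (mkCoord ppsi) erefl.
  exists (m + m')%N; have -> : h = mkCoord pphi * mkCoord ppsi by exact: val_inj.
  by rewrite wmulM; exact: filtM.
Qed.

Lemma weyl_span (a : weyl V) : exists m, filt wgen m a.
Proof.
suff H D : gen_subalg (range (@mulop k V) `|` range (@derivop k V))%classic D ->
    forall b : weyl V, val b = D -> exists m, filt wgen m b.
  by apply: (H (val a)) => //; exact/asboolP/(valP a).
elim=> {D} [D [] [f _ <-]|b bE|c D E HD IHD HE IHE b bE|D E HD IHD HE IHE b bE].
- move=> b bE; have -> : b = wmul f by exact: val_inj.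
  exact: filt_wmul.
- move=> b bE; have -> : b = wder f by exact: val_inj.
  exists 1%N; rewrite (basis_decomp f) linear_sum; apply: filt_sum => i.
  by rewrite linearZ; apply: filtZ; exact: (filt_gen0 (inr i)).
- have -> : b = 1 by exact: val_inj.
  by exists 0%N; exact: filt1.
- pose bD : weyl V := exist _ D (introT (asboolP _) HD).
  pose bE' : weyl V := exist _ E (introT (asboolP _) HE).
  have [m Fm] := IHD bD erefl; have [m' Fm'] := IHE bE' erefl.
  exists (maxn m m'); have -> : b = c *: bD + bE' by exact: val_inj.
  by apply: filt_lin; [apply: filt_le Fm | apply: filt_le Fm']; rewrite leq_max leqnn ?orbT.
- pose bD : weyl V := exist _ D (introT (asboolP _) HD).
  pose bE' : weyl V := exist _ E (introT (asboolP _) HE).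
  have [m Fm] := IHD bD erefl; have [m' Fm'] := IHE bE' erefl.
  exists (m + m')%N; have -> : b = bD * bE' by exact: val_inj.
  exact: filtM.
Qed.

(** The matrix of the symplectic form that the commutator induces on the span of the x_i and d_i. *)
Definition womega (s t : 'I_n + 'I_n) : k := match s, t with
  | inr i, inl j => (i == j)%:R
  | inl j, inr i => - (i == j)%:R
  | _, _ => 0
  end.

Lemma dop_xop (i j : 'I_n) : dop i * xop j - xop j * dop i = (i == j)%:R%:A.
Proof.
rewrite wder_wmul_lin; congr (_ *: _); rewrite /= /coord_fun coord_free //.
exact: basis_free e_basis.
Qed.

Lemma wgen_comm s t : wgen s * wgen t - wgen t * wgen s = (womega s t)%:A.
Proof.
case: s t => [i|i] [j|j] /=.
- by rewrite wmul_comm subrr scale0r.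
- by rewrite -opprB dop_xop scaleNr.
- exact: dop_xop.
- by rewrite wder_comm subrr scale0r.
Qed.

Lemma deriv_eq0 (p : {poly k}) : (forall t, p^`().[t] = 0) -> p = (p`_0)%:P.
Proof.
move=> p'0; have {}p'0 : p^`() = 0.
  apply/eqP/negPn/negP => /closed_nonrootP[t].
  by rewrite rootE p'0 eqxx.
apply/polyP => -[|i]; rewrite coefC //=.
have /eqP := congr1 (fun r : {poly k} => r`_i) p'0.
rewrite coef_deriv coef0 -mulr_natr mulf_eq0.
by move/pcharf0P: char0 => ->; rewrite orbF => /eqP.
Qed.

(** On the line from 0 to [u] the function is a polynomial in one variable with zero derivative,
    hence constant in characteristic 0. *)
Lemma polyfun_const (h : V -> k^o) : polyfun h ->
  (forall v u, dir_deriv v h u = 0) -> forall u, h u = h 0.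
Proof.
move=> ph h0 u; have pE := line_polyE u 0 ph.
set p := line_poly h u 0 in pE.
have pC : p = (p`_0)%:P.
  apply: deriv_eq0 => t; rewrite -(h0 u (t *: u)) /dir_deriv.
  (* Directional derivatives are taken at parameter 0, so the base point is shifted to [t *: u] by
     substituting X + t. *)
  rewrite (@line_poly_unique _ _ _ _ _ (p \Po ('X + t%:P))).
    by rewrite deriv_comp derivD derivX derivC addr0 mulr1 horner_comp !hornerE.
  by move=> s; rewrite horner_comp !hornerE pE add0r scalerDl addrC.
have := pE 0; rewrite pC hornerC scale0r addr0 => <-.
by have := pE 1; rewrite {1}pC hornerC add0r scale1r => ->.
Qed.

Lemma weyl_linear (a : weyl V) : linear (val (val a)).
Proof. exact: endCoordP. Qed.

Lemma weyl0 (a : weyl V) : val (val a) 0 = 0.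
Proof. by have := weyl_linear a (-1) 0 0; rewrite scaleN1r addNr scaleN1r addNr. Qed.

Lemma wder1 v : val (val (wder v)) 1 = 0.
Proof. by apply/val_inj; exact: dir_deriv_cst. Qed.

(** Commuting with multiplications forces [a] to be multiplication by [h], its value at 1. Commuting
    with derivations makes all derivatives of [h] vanish, so [h] is constant. *)
Lemma weyl_central (a : weyl V) :
  (forall t, wgen t * a = a * wgen t) -> exists c, a = c%:A.
Proof.
move=> /(commute_gen weyl_span) Ca; set h := val (val a) 1.
have hder v u : dir_deriv v (val h) u = 0.
  have /weyl_eqP/(_ 1 u) := Ca (wder v).
  rewrite [LHS](_ : _ = dir_deriv v (val h) u) // => ->.
  by rewrite [LHS](_ : _ = val (val (val a) (val (val (wder v)) 1)) u) // wder1 weyl0.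
exists (val h 0); apply/weyl_eqP => f u.
have /weyl_eqP/(_ 1 u) := Ca (wmul f).
rewrite [LHS](_ : _ = (val f u : k) * val h u) //.
rewrite [RHS](_ : _ = val (val (val a) (f * 1)) u) // mulr1 => <-.
rewrite [RHS](_ : _ = (val h 0 : k) * val f u) // mulrC.
by rewrite (polyfun_const (coordRingP h) hder).
Qed.

(** Each commutator lowers the filtration degree, and in degree 0 it vanishes. *)
Lemma iter_ad_nil t (a : weyl V) :
  exists M, forall m, (M <= m)%N -> iter m (ad (wgen t)) a = 0.
Proof.
have [M FM] := weyl_span a; exists M.+1 => m Mm.
have -> : m = (m - M.+1 + M.+1)%N by rewrite subnK.
rewrite iterD (_ : iter M.+1 _ a = 0).
  by elim: (m - _)%N => //= l ->; rewrite linear0.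
elim: M a FM {Mm} => [|M IH] a FM.
  exact: (filt_ad wgen_comm t FM).2.
by rewrite iterSr IH //; exact: (filt_ad wgen_comm t FM).1.
Qed.

Variables (K : GLsubgroup V) (g : 'End(V)) (m : 'I_n -> int).
Hypothesis Kg : K g.
Hypothesis g_e : forall i : 'I_n, g e`_i = 2 ^ m i *: e`_i.
Hypothesis m_neq0 : forall i, m i != 0.

Definition wwt (t : 'I_n + 'I_n) := match t with inl i => - m i | inr i => m i end.

Let GLg : GL g := GLset_sub Kg.

Definition wconj (a : weyl V) : weyl V :=
  exist _ (conjop g (val a)) (conjop_weyl GLg (valP a)).

Lemma wconj_linear : linear wconj.
Proof. by move=> c a b; apply/val_inj; exact: (conjop_lin g c (val a) (val b)). Qed.

Lemma wconjM : {morph wconj : a b / a * b}.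
Proof. by move=> a b; apply/val_inj; exact: (conjopM (val a) (val b) GLg). Qed.

Let two_neq0 : (2 : k) != 0.
Proof. by move/pcharf0P: char0 => ->. Qed.

Lemma wconj_gen t : wconj (wgen t) = 2 ^ wwt t *: wgen t.
Proof.
case: t => i /=; apply/val_inj => /=; last first.
  rewrite conjop_derivop // g_e.
  have E : wder (2 ^ m i *: e`_i) = 2 ^ m i *: wder e`_i by rewrite linearZ.
  exact: (congr1 (val : weyl V -> endCoord V) E).
rewrite conjop_mulop //.
have -> : val (actop g) (lin_fun (coord_fun i)) = 2 ^ (- m i) *: lin_fun (coord_fun i).
  apply/val_inj/funext => v /=; rewrite /coord_fun.
  rewrite [RHS](_ : _ = 2 ^ (- m i) * coord e i v) //.
  (* Applying [g] to [g^-1 v] expanded in the eigenbasis multiplies the [i]-th coordinate by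
     2^(m_i). *)
  have -> : coord e i v = 2 ^ m i * coord e i (g^-1%VF v).
    rewrite -{1}[v](lker0_lfunVK GLg) {1}(basis_decomp (g^-1%VF v)) linear_sum.
    under eq_bigr => j _ do rewrite linearZ /= g_e scalerA.
    by rewrite coord_sum_free ?(basis_free e_basis) // mulrC.
  by rewrite mulrA -expfzDr // addNr expr0z mul1r.
have E c f : wmul (c *: f) = c *: wmul f by rewrite linearZ.
exact: (congr1 (val : weyl V -> endCoord V) (E _ _)).
Qed.

Definition weyl_incl (a : weyl_inv K) : weyl V := val a.
HB.instance Definition _ := GRing.isLinear.Build k _ _ _ weyl_incl
  (fun c a b => linearP (val : {linear weyl_inv K -> weyl V}) c a b).
HB.instance Definition _ :=
  GRing.RMorphism.copy weyl_incl (val : {rmorphism weyl_inv K -> weyl V}).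

Theorem enough_fd_weyl_inv : enough_fd_modules (weyl_inv K).
Proof.
(* For these indices the generator of negative weight is x_i; for the others it is d_i. *)
pose S := [seq i <- enum 'I_n | 0 < m i].
(* The constant term of [a] applied to 1. It kills [d * dop i], as 1 has zero derivative, and
   [xop i * d], as coordinates vanish at 0. Flipping at [S] makes it kill the left ideal generated
   by the generators of negative weight. *)
pose phi0 (a : weyl V) : k^o := val (val (val a) 1) 0.
have [] := @exists_flipped k (weyl V) 'I_n xop dop phi0 S char0.
- by move=> i; rewrite dop_xop eqxx scale1r.
- move=> i j ij; apply/eqP; rewrite -subr_eq0 dop_xop (negbTE ij) scale0r //.
- by move=> i j; exact: wmul_comm.
- by move=> i j; exact: wder_comm.
- by move=> i; exact: (iter_ad_nil (inr i)).
- by [].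
- by [].
- move=> i d; rewrite /phi0.
  rewrite [LHS](_ : _ = (coord_fun i 0 : k) * val (val (val d) 1) 0) //.
  by rewrite linear0 mul0r.
- move=> i d; rewrite /phi0.
  rewrite [LHS](_ : _ = val (val (val d) (val (val (dop i)) 1)) 0) //.
  by rewrite wder1 weyl0.
move=> phi [phi_lin phi1 phix phid].
apply: (@enough_fd_graded0 k (weyl V) _ wgen womega wwt phi _ weyl_incl) => //.
- exact: wgen_comm.
- case=> i [j|j] /=; rewrite ?oppr_eq0 ?eqxx //.
    by have [->|] := eqVneq j i; rewrite ?eqxx.
  by have [->|] := eqVneq i j; rewrite ?eqxx ?opprK.
- by case=> i; rewrite /= ?oppr_eq0 m_neq0.
- exact: weyl_span.
- exact: weyl_central.
- case=> i d /=.
    by rewrite oppr_lt0 => mi; apply: phix; rewrite mem_filter mi mem_enum.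
  by move=> mi; apply: phid; rewrite mem_filter lt_gtF.
(* An invariant of [K] is fixed by conjugation with [g], and 2 is not a root of unity, so it has
   weight 0. *)
- move=> b; have [M FM] := weyl_span (weyl_incl b).
  apply: (@invariant_graded0 k (weyl V) _ wgen wwt 2 wconj) FM _ => //.
  + by move=> w; exact: exp2_eq1.
  + exact: wconj_linear.
  + by apply/val_inj; exact: conjop1.
  + exact: wconjM.
  + exact: wconj_gen.
  + by apply/val_inj => /=; have /asboolP := valP b; apply.
Qed.

End WeylGenerators.

Theorem theoremD (k : closedFieldType) (char0 : [pchar k]%R =i pred0)
    (V : vectType k) (K G : GLsubgroup V) :
  is_reductive K ->
  is_maximal_torus K G ->
  ~ is_weight G (@weight0 k V) ->
  enough_fd_modules (weyl_inv K).
Proof.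
move=> _ [torusG GK _] /weight0P fixG.
have [n [e [g [m [e_basis Gg g_e m_neq0]]]]] := torus_eigenbasis char0 torusG fixG.
exact: (enough_fd_weyl_inv char0 e_basis (GK g Gg) g_e m_neq0).
Qed.
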